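(* The Minkowski (box-counting) dimension of $X_\Omega$ exists and $$ \dim_M(X_\Omega)=\sum_{p=1}^{p_{d-1}}\delta_p^{d,d-1}\log_{m_d}|\mathrm{Pref}_{0,\dots,0,p}(\Omega)|+\sum_{s=2}^{d-1}\ \sum_{p=p_s+1}^{p_{s-1}}\ \sum_{t=s-1}^{d-1}\delta_p^{s,t}\log_{m_d}|\mathrm{Pref}_{0,\dots,0,\,p-p_s^{s,t},\,p_s^{s,t}-p_{s+1}^{s,t},\dots,\,p_{d-2}^{s,t}-p_{d-1}^{s,t},\,p_{d-1}^{s,t}}(\Omega)| $$ $$ +\sum_{p=p_1+1}^\infty\ \sum_{t=0}^{d-1}\delta_p^{1,t}\log_{m_d}|\mathrm{Pref}_{p-p_1^{1,t},\,p_1^{1,t}-p_2^{1,t},\dots,\,p_{d-2}^{1,t}-p_{d-1}^{1,t},\,p_{d-1}^{1,t}}(\Omega)|, $$ where in the middle sum the index of $\mathrm{Pref}$ starts with $s-1$ zeros, so that it has $d$ entries in total.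
   Context: Setting. Let $d\ge2$, $q\ge2$ and $m_1\ge\cdots\ge m_d\ge2$ be integers, $\mathcal{A}_k=\{0,\dots,m_k-1\}$, $\mathbb{N}^*=\{1,2,\dots\}$, $\Sigma=(\mathcal{A}_1\times\cdots\times\mathcal{A}_d)^{\mathbb{N}^*}$, with elements $x=(x_i)_{i\ge1}$, $x_i=(x_i^1,\dots,x_i^d)$. Let $\Omega\subset\Sigma$ be nonempty and closed (product topology), $X_\Omega=\{x\in\Sigma:(x_{iq^\ell})_{\ell\ge0}\in\Omega\ \forall i\ge1,\ q\nmid i\}$. Balls. For $2\le i\le d$ let $\gamma_i=\log(m_i)/\log(m_{i-1})$ and $L_i(n)=\lceil n/\gamma_i\rceil$; $L_1$ is the identity. Let $B_n(x)=\{u\in\Sigma:\forall 1\le k\le d,\ \forall 1\le i\le(L_k\circ\cdots\circ L_1)(n),\ u_i^k=x_i^k\}$; $\Sigma$ carries the metric for which these are the closed balls of radius $m_1^{-n}$ (distance $m_1^{-\sup\{n\ge0:u\in B_n(x)\}}$ between $x$ and $u$). Thus $\dim_M(X_\Omega)=\lim_n\frac1n\log_{m_1}(\text{number of distinct balls }B_n\text{ meeting }X_\Omega)$. Prefixes. For $n_1,\dots,n_d\in\mathbb{N}$ and $u\in\prod_{i=1}^d(\mathcal{A}_i\times\cdots\times\mathcal{A}_d)^{n_i}$, the generalized cylinder $[u]$ is the set of $x\in\Sigma$ such that reading $x$ from position 1, the first $n_1$ positions have coordinates $1,\dots,d$ prescribed by $u$, the next $n_2$ positions have coordinates $2,\dots,d$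 prescribed by $u$, ..., the last $n_d$ positions (up to $n_1+\cdots+n_d$) have coordinate $d$ prescribed by $u$. $\mathrm{Pref}_{n_1,\dots,n_d}(\Omega)=\{u\in\prod_{i=1}^d(\mathcal{A}_i\times\cdots\times\mathcal{A}_d)^{n_i}:\Omega\cap[u]\ne\varnothing\}$. Parameters. For $1\le k\le d-1$ let $p_k$ be the non-negative integer with $q^{p_k}\le\frac{1}{\gamma_d\gamma_{d-1}\cdots\gamma_{k+1}}<q^{p_k+1}$, and $a_k=q^{p_k}\prod_{i=k+1}^d\gamma_i$. For $1\le s\le d-1$ let $\sigma_s$ be the permutation of $\{s,\dots,d-1\}$ for which $(a_{\sigma_s(t)})_{s\le t\le d-1}$ is non-decreasing, ties being ordered by increasing index. For $1\le s\le d-1$, $s-1\le t\le d-1$, $s\le k\le d-1$ let $p_k^{s,t}=p_k+1$ if $k\in\sigma_s(\{s,\dots,t\})$ and $p_k^{s,t}=p_k$ otherwise. Weights. For $p\ge1$: $\delta_p^{d,d-1}=\frac{(q-1)^2}{q^{p+1}}$; and for $1\le s\le d-1$: $\delta_p^{s,s-1}=\frac{(q\,a_{\sigma_s(s)}-1)(q-1)}{q^{p+1}}$, $\delta_p^{s,t}=\frac{(a_{\sigma_s(t+1)}-a_{\sigma_s(t)})(q-1)}{q^p}$ for $s\le t\le d-2$, $\delta_p^{s,d-1}=\frac{(1-a_{\sigma_s(d-1)})(q-1)}{q^p}$. *)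

(* Defs.v *)
From HB Require Import structures.
From mathcomp Require Import all_boot all_order all_algebra.
From mathcomp Require Import all_classical all_reals all_analysis.

Set Implicit Arguments.
Unset Strict Implicit.
Unset Printing Implicit Defensive.

Import Order.TTheory GRing.Theory Num.Theory.
Import numFieldNormedType.Exports.

Local Open Scope classical_set_scope.
Local Open Scope ring_scope.

(* Indexing.  Families m, p, n, ... are functions on nat, read at the indices
   1, ..., d of the mathematical text.  A coordinate is an element of 'I_d, the
   ordinal k standing for the coordinate k.+1.  A sequence indexed by the
   positions 1, 2, ... is a function on nat whose value at i is the letter at
   position i.+1. *)

(** * Box-counting dimension with respect to a distance function *)

Definition covered_by (R : realType) (T : Type) (dist : T -> T -> R)
    (X : set T) (r : R) (N : nat) : Prop :=
  exists c : 'I_N -> T, forall u, X u -> exists i, dist (c i) u <= r.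

Definition is_covering_number (R : realType) (T : Type) (dist : T -> T -> R)
    (X : set T) (r : R) (N : nat) : Prop :=
  covered_by dist X r N /\
  forall N', covered_by dist X r N' -> (N <= N')%N.

Definition has_minkowski_dim (R : realType) (T : Type) (dist : T -> T -> R)
    (X : set T) (D : R) : Prop :=
  exists N : R -> nat,
    (forall r, 0 < r -> is_covering_number dist X r (N r)) /\
    (fun r : R => ln (N r)%:R / ln r^-1) @ 0^'+ --> D.

(** * The symbolic space *)

Definition Sigma (d : nat) (m : nat -> nat) : topologicalType :=
  prod_topology (fun _ : nat =>
    prod_topology (fun k : 'I_d => discrete_topology 'I_(m k.+1))).

(* The position i q^l is stored at index (i q^l).-1. *)
Definition X_ (d : nat) (m : nat -> nat) (q : nat) (Omega : set (Sigma d m)) :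
    set (Sigma d m) :=
  [set x : Sigma d m | forall i : nat, (0 < i)%N -> ~~ (q %| i)%N ->
     Omega (fun l : nat => x (i * q ^ l).-1)].

Definition gamma (R : realType) (m : nat -> nat) (i : nat) : R :=
  ln (m i)%:R / ln (m i.-1)%:R.

Definition L_ (R : realType) (m : nat -> nat) (i n : nat) : nat :=
  if (i <= 1)%N then n else `|Num.ceil (n%:R / gamma R m i)|%N.

(* L_k o ... o L_1 *)
Fixpoint Lcomp (R : realType) (m : nat -> nat) (k n : nat) : nat :=
  if k is k'.+1 then L_ R m k (Lcomp R m k' n) else n.

Definition B_ (R : realType) (d : nat) (m : nat -> nat) (n : nat)
    (x : Sigma d m) : set (Sigma d m) :=
  [set u : Sigma d m | forall (k : 'I_d) (i : nat),
     (i < Lcomp R m k.+1 n)%N -> u i k = x i k].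

(* The supremum is infinite exactly when u = x, and the distance is then 0. *)
Definition dist (R : realType) (d : nat) (m : nat -> nat) (x u : Sigma d m) : R :=
  match ereal_sup [set (n%:R : R)%:E | n in [set n : nat | B_ R n x u]] with
  | r%:E => (m 1)%:R `^ (- r)
  | _ => 0
  end.

(** * Prefixes *)

Definition word (d : nat) (m n : nat -> nat) : finType :=
  {dffun forall i : 'I_d, {ffun 'I_(n i.+1) ->
    {dffun forall k : {k : 'I_d | (i <= k)%N}, 'I_(m (val k).+1)}}}.

Definition cyl (d : nat) (m n : nat -> nat) (u : word d m n) :
    set (Sigma d m) :=
  [set x : Sigma d m |
    forall (i : 'I_d) (r : 'I_(n i.+1)) (k : {k : 'I_d | (i <= k)%N}),
      x (\sum_(1 <= j < i.+1) n j + r)%N (val k) = u i r k].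

Definition Pref (d : nat) (m n : nat -> nat) (Omega : set (Sigma d m)) :
    {set word d m n} :=
  [set u : word d m n | `[< Omega `&` cyl u !=set0 >]]%SET.

Definition log_pref (R : realType) (d : nat) (m : nat -> nat)
    (Omega : set (Sigma d m)) (n : nat -> nat) : R :=
  ln (#|Pref n Omega|)%:R / ln (m d)%:R.

(** * Parameters and weights *)

(* 1 / (gamma_d ... gamma_{k+1}) lies between q^(p_k) and q^(p_k + 1). *)
Definition is_p (R : realType) (d : nat) (m : nat -> nat) (q : nat)
    (p : nat -> nat) : Prop :=
  forall k, (1 <= k <= d.-1)%N ->
    q%:R ^+ p k <= (\prod_(k.+1 <= i < d.+1) gamma R m i)^-1 < q%:R ^+ (p k).+1.

Definition a_ (R : realType) (d : nat) (m : nat -> nat) (q : nat)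
    (p : nat -> nat) (k : nat) : R :=
  q%:R ^+ p k * \prod_(k.+1 <= i < d.+1) gamma R m i.

Definition is_sigma (R : realType) (d : nat) (a : nat -> R)
    (sigma : nat -> nat -> nat) : Prop :=
  forall s, (1 <= s <= d.-1)%N ->
    perm_eq [seq sigma s t | t <- iota s (d - s)] (iota s (d - s)) /\
    forall t t', (s <= t)%N -> (t < t')%N -> (t' <= d.-1)%N ->
      a (sigma s t) <= a (sigma s t') /\
      (a (sigma s t) = a (sigma s t') -> (sigma s t < sigma s t')%N).

(* p_k^{s,t}; the list is sigma_s({s, ..., t}), empty for t = s - 1. *)
Definition p_st (p : nat -> nat) (sigma : nat -> nat -> nat)
    (s t k : nat) : nat :=
  if k \in [seq sigma s i | i <- iota s (t.+1 - s)] then (p k).+1 else p k.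

Definition delta (R : realType) (d q : nat) (a : nat -> R)
    (sigma : nat -> nat -> nat) (s t r : nat) : R :=
  if s == d then (q%:R - 1) ^+ 2 / q%:R ^+ r.+1
  else if t == s.-1 then
    (q%:R * a (sigma s s) - 1) * (q%:R - 1) / q%:R ^+ r.+1
  else if t == d.-1 then
    (1 - a (sigma s d.-1)) * (q%:R - 1) / q%:R ^+ r
  else (a (sigma s t.+1) - a (sigma s t)) * (q%:R - 1) / q%:R ^+ r.

(* 0, ..., 0, r *)
Definition last_lengths (d r : nat) (j : nat) : nat :=
  if j == d then r else 0%N.

(* For P = p^{s,t}: s - 1 zeros, then
   r - P_s, P_s - P_{s+1}, ..., P_{d-2} - P_{d-1}, P_{d-1}.
   The truncated subtractions are genuine for r > p_s. *)
Definition prefix_lengths (d s : nat) (P : nat -> nat) (r : nat)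
    (j : nat) : nat :=
  if (j < s)%N then 0%N
  else if j == s then (r - P s)%N
  else if (j < d)%N then (P j.-1 - P j)%N
  else P d.-1.

(* The sum over t of delta_r^{s,t} log |Pref|, for 1 <= s <= d - 1. *)
Definition level_term (R : realType) (d : nat) (m : nat -> nat) (q : nat)
    (Omega : set (Sigma d m)) (p : nat -> nat) (sigma : nat -> nat -> nat)
    (s r : nat) : R :=
  \sum_(s.-1 <= t < d)
    delta d q (a_ R d m q p) sigma s t r *
    log_pref R Omega (prefix_lengths d s (p_st p sigma s t) r).

(* Main.v *)
Require Import Defs.
From HB Require Import structures.
From mathcomp Require Import all_boot all_order all_algebra.
From mathcomp Require Import all_classical all_reals all_analysis.
From mathcomp Require Import ring lra zify.

Set Implicit Arguments.
Unset Strict Implicit.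
Unset Printing Implicit Defensive.

Import Order.TTheory GRing.Theory Num.Theory.
Import numFieldNormedType.Exports.

Local Open Scope classical_set_scope.
Local Open Scope ring_scope.

(** A point of X_Omega is a free choice of a point of Omega on each progression
    i, iq, iq^2, ... with q not dividing i.  The ball B_n fixes coordinate k at
    the positions up to ell_k = (L_k o ... o L_1)(n); on the progression of i
    this is coordinate k of the first #{l : i q^l <= ell_k} terms.  Hence the
    number of balls B_n that meet X_Omega is the product over i <= ell_d, q not
    dividing i, of the number of prefixes of Omega of the shape seen along the
    progression of i ([nvalues_fiber_table], [covering_number_X]), and its
    logarithm is a sum over i.

    Up to a bounded error, ell_k = g_k ell_d with g_k = gamma_{k+1} ... gamma_d
    ([Lcomp_gap]), so the shape depends on i / ell_d only.  Write
    i / ell_d = y / q^(r-1) with 1/q < y <= 1 and r >= 1.  Coordinate d is then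
    seen r times, and coordinate k < d, because a_k = q^(p_k) g_k lies in
    (1/q, 1], is seen r - p_k times if y <= a_k and r - p_k - 1 times if
    y > a_k, these numbers being read as 0 when r <= p_k ([fiber_profile]).  So
    for a fixed level r the shape is a step function of y which jumps at the
    a_k with p_k < r, listed in increasing order by sigma_s, where
    p_s < r <= p_{s-1}.  The weight delta_r^{s,t} is the length of the t-th
    step, scaled by q^(-(r-1)), times the density 1 - 1/q of the integers that
    q does not divide ([deltaE]).

    Counting the integers of each step with a bounded error ([step_sum]) gives
    the limit of the contribution of each level r, relative to ell_d
    ([level_sum_cvg]).  A level has at most ell_d / q^(r-1) integers, each
    contributing O(r), so a dominated convergence argument for series adds the
    levels up ([level_sum_bound], [tannery], [fiber_entropy_mean_cvg]).

    Finally, covering by balls of a small radius rho amounts to counting the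
    balls B_n for one n = n(rho) ([dist_le], [nvalues_covering]), and
    ell_d(n(rho)) is equivalent to log (1/rho) / log m_d
    ([last_length_ball_index_cvg]); this last constant is the origin of the
    logarithms to the base m_d. *)

(** * Counting the values of an observation *)

Definition nvalues (T : Type) (F : finType) (f : T -> F) (A : set T) : nat :=
  #|[set w : F | `[< exists2 x, A x & f x = w >]]%SET|.

(** By hypothesis f x is, on A, a function of g x. *)
Lemma nvalues_le (T : Type) (F G : finType) (f : T -> F) (g : T -> G)
    (A : set T) :
  (forall x y, A x -> A y -> g x = g y -> f x = f y) ->
  (nvalues f A <= nvalues g A)%N.
Proof.
move=> fg; rewrite /nvalues.
have [[x0 Ax0]|A0] := pselect (exists x, A x); last first.
  rewrite (_ : finset _ = finset.set0) ?cards0//; apply/setP => w.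
  rewrite !inE; apply/negbTE/negP => /asboolP[x Ax _]; apply: A0.
  by exists x.
pose r (v : G) :=
  if pselect (exists2 x, A x & g x = v) is left vP then f (s2val (cid2 vP))
  else f x0.
set V := (X in (_ <= #|pred_of_set X|)%N).
apply: leq_trans (leq_imset_card r V); apply: subset_leq_card.
apply/fintype.subsetP => w; rewrite inE => /asboolP[x Ax <-].
apply/imsetP; exists (g x).
  by rewrite inE; apply/asboolP; exists x.
rewrite /r; case: pselect => [gx|[]]; last by exists x.
by case: cid2 => y Ay gyx; exact: fg.
Qed.

Lemma nvalues_eq (T : Type) (F G : finType) (f : T -> F) (g : T -> G)
    (A : set T) :
  (forall x y, A x -> A y -> f x = f y <-> g x = g y) ->
  nvalues f A = nvalues g A.
Proof.
move=> fg; apply/eqP; rewrite eqn_leq !nvalues_le// => x y Ax Ay.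
- by move/(fg x y Ax Ay).
- by move/(fg x y Ax Ay).
Qed.

Lemma nvalues_gt0 (T : Type) (F : finType) (f : T -> F) (A : set T) :
  A !=set0 -> (0 < nvalues f A)%N.
Proof.
move=> [x Ax]; apply/card_gt0P; exists (f x).
by rewrite inE; apply/asboolP; exists x.
Qed.

(** When the balls of radius r are the fibres of f, a covering needs one centre
    for each value of f on A; one centre in each fibre that meets A suffices. *)
Lemma nvalues_covering (R : realType) (T : Type) (F : finType)
    (dst : T -> T -> R) (f : T -> F) (A : set T) (r : R) :
  (forall x u, dst x u <= r <-> f u = f x) ->
  is_covering_number dst A r (nvalues f A).
Proof.
move=> df; split.
- pose V := [set w : F | `[< exists2 x, A x & f x = w >]]%SET.
  have rep (i : 'I_#|V|) : {x | A x & f x = enum_val i}.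
    by apply: cid2; apply/asboolP; have := enum_valP i; rewrite inE.
  exists (fun i => s2val (rep i)) => u Au.
  have fuV : f u \in V by rewrite inE; apply/asboolP; exists u.
  exists (enum_rank_in fuV (f u)); apply/df.
  by rewrite (s2valP' (rep _)) enum_rankK_in.
- move=> N [c cP]; rewrite /nvalues -[N in (_ <= N)%N]card_ord.
  apply: leq_trans (leq_imset_card (fun i => f (c i)) 'I_N).
  apply: subset_leq_card; apply/fintype.subsetP => w.
  rewrite inE => /asboolP[x Ax <-]; have [i ci] := cP _ Ax.
  by apply/imsetP; exists i => //; apply/df.
Qed.

(** The tuple of observations (f i)_i of the points of A takes every combination
    of the values that the g i take on the B i, so their numbers multiply.  This
    is how the independence of the progressions enters the count. *)
Lemma nvalues_family (T S : Type) (n : nat) (F : 'I_n -> finType)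
    (f : forall i, T -> F i) (g : forall i, S -> F i)
    (A : set T) (B : 'I_n -> set S) :
  (forall x, A x -> forall i, exists2 y, B i y & g i y = f i x) ->
  (forall y : 'I_n -> S, (forall i, B i (y i)) ->
     exists2 x, A x & forall i, f i x = g i (y i)) ->
  nvalues (fun x => [ffun i => f i x] : {dffun forall i, F i}) A =
  (\prod_i nvalues (g i) (B i))%N.
Proof.
move=> AB BA.
pose V i := [set w : F i | `[< exists2 y, B i y & g i y = w >]]%SET.
(* The set of values of the table is the product of the sets V i. *)
rewrite /nvalues -(cardsXn V); apply: eq_card => w.
rewrite inE; apply/asboolP/setXnP => [[x Ax <-] i|Vw].
  rewrite ffunE inE; apply/asboolP.
  by have [y By gy] := AB _ Ax i; exists y.
have rep i : {y | B i y & g i y = w i}.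
  by apply: cid2; apply/asboolP; have := Vw i; rewrite inE.
have [x Ax fx] := BA (fun i => s2val (rep i)) (fun i => s2valP (rep i)).
exists x => //; apply/ffunP => i; rewrite ffunE fx.
exact: (s2valP' (rep i)).
Qed.

(** * Observing the first letters of each coordinate *)

(** The finite type in which the first h k values of each coordinate k live. *)
Definition window (d : nat) (m : nat -> nat) (h : 'I_d -> nat) : finType :=
  {dffun forall k : 'I_d, {ffun 'I_(h k) -> 'I_(m k.+1)}}.

Definition restr (d : nat) (m : nat -> nat) (h : 'I_d -> nat)
    (x : Sigma d m) : window m h :=
  [ffun k => [ffun l : 'I_(h k) => x l k]].

Lemma restrP (d : nat) (m : nat -> nat) (h : 'I_d -> nat) (x y : Sigma d m) :
  restr h x = restr h y <->
  forall (k : 'I_d) (l : nat), (l < h k)%N -> x l k = y l k.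
Proof.
split=> [/ffunP xy k l lh|xy].
  by have := xy k; rewrite !ffunE => /ffunP /(_ (Ordinal lh)); rewrite !ffunE.
by apply/ffunP => k; rewrite !ffunE; apply/ffunP => l; rewrite !ffunE xy.
Qed.

(** The quantities |Pref| of the statement, indexed by the number of observed
    values of each coordinate instead of by the lengths of the blocks; see
    [card_Pref]. *)
Definition patterns (d : nat) (m : nat -> nat) (Omega : set (Sigma d m))
    (h : 'I_d -> nat) : nat := nvalues (@restr d m h) Omega.

Lemma block_decomp (n : nat -> nat) (k l : nat) :
  (l < \sum_(1 <= j < k.+2) n j)%N ->
  exists i r, [/\ (i <= k)%N, (r < n i.+1)%N &
    l = (\sum_(1 <= j < i.+1) n j + r)%N].
Proof.
elim: k => [|k IH] lk.
  by exists 0%N, l; rewrite big_geq//; split=> //; rewrite big_nat1 in lk.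
have [/IH[i [r [ik rn ->]]]|lk'] := ltnP l (\sum_(1 <= j < k.+2) n j).
  by exists i, r; split=> //; apply: ltnW.
exists k.+1, (l - \sum_(1 <= j < k.+2) n j)%N; split=> //; last by rewrite subnKC.
by rewrite ltn_subLR// addnC addnC -big_nat_recr.
Qed.

(** Coordinate k + 1 is prescribed in the first k + 1 blocks, which are
    contiguous: it is prescribed up to the sum of their lengths. *)
Lemma card_Pref (d : nat) (m n : nat -> nat) (Omega : set (Sigma d m)) :
  #|Pref n Omega| =
  patterns Omega (fun k => \sum_(1 <= j < k.+2) n j)%N.
Proof.
pose rd (x : Sigma d m) : word d m n :=
  [ffun i : 'I_d => [ffun r : 'I_(n i.+1) =>
    [ffun k : {k : 'I_d | (i <= k)%N} =>
      x (\sum_(1 <= j < i.+1) n j + r)%N (val k)]]].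
have rdP (x : Sigma d m) (u : word d m n) : cyl u x <-> rd x = u.
  split=> [xu|<- i r k]; last by rewrite !ffunE.
  apply/ffunP => i; rewrite ffunE; apply/ffunP => r; rewrite ffunE.
  by apply/ffunP => k; rewrite ffunE; exact: xu.
transitivity (nvalues rd Omega).
  apply: eq_card => u; rewrite !inE; apply/asboolP/asboolP.
    by move=> [x [Ox /rdP xu]]; exists x.
  by move=> [x Ox /rdP xu]; exists x.
apply: nvalues_eq => x y _ _; split.
  move=> xy; apply/restrP => k l /block_decomp[i [r [ik rn ->]]].
  have id' : (i < d)%N by exact: leq_ltn_trans (ltn_ord k).
  have /ffunP/(_ (Ordinal id')) := xy; rewrite !ffunE.
  move=> /ffunP/(_ (Ordinal rn)); rewrite !ffunE.
  move=> /ffunP/(_ (exist _ k ik)); by rewrite !ffunE.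
move=> /restrP xy; apply/rdP => i r [k ik]; rewrite !ffunE /=.
apply: xy.
rewrite [ltnRHS](@big_cat_nat _ _ _ i.+2)//= ?ltnS//.
by rewrite [X in (_ < X + _)%N]big_nat_recr//= -[ltnRHS]addnA ltn_add2l ltn_addr.
Qed.

(** * Decomposition of the positions along geometric progressions *)

(** The number of l such that i q^l <= L; see [ltn_count_powers]. *)
Definition count_powers (q L i : nat) : nat :=
  if (i <= L)%N then (trunc_log q (L %/ i)).+1 else 0%N.

Lemma ltn_count_powers (q L i l : nat) : (1 < q)%N -> (0 < i)%N ->
  (l < count_powers q L i)%N = (i * q ^ l <= L)%N.
Proof.
move=> q1 i0; rewrite /count_powers; case: (leqP i L) => iL; last first.
  rewrite ltn0; apply/esym/negbTE; rewrite -ltnNge; apply: leq_trans iL _.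
  by rewrite leq_pmulr// expn_gt0 (ltnW q1).
rewrite ltnS mulnC -leq_divRL//; apply/idP/idP => [lt|]; last first.
  exact: trunc_log_max.
apply: leq_trans (trunc_logP q1 _); last by rewrite divn_gt0.
by rewrite leq_exp2l.
Qed.

Lemma count_powers_eq (q L i e : nat) : (1 < q)%N -> (0 < i)%N ->
  (L < i * q ^ e)%N -> ((0 < e)%N -> (i * q ^ e.-1 <= L)%N) ->
  count_powers q L i = e.
Proof.
move=> q1 i0 lt le; apply/eqP; rewrite eqn_leq; apply/andP; split.
  by rewrite leqNgt ltn_count_powers// -ltnNge.
by case: e {lt} le => // e /(_ isT); rewrite ltn_count_powers.
Qed.

Lemma qadic_ex (q j : nat) : (1 < q)%N -> (0 < j)%N ->
  exists i l, [/\ (0 < i)%N, ~~ (q %| i)%N & j = (i * q ^ l)%N].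
Proof.
move=> q1; elim/ltn_ind: j => j IH j0.
have [qj|nqj] := boolP (q %| j)%N; last by exists j, 0%N; rewrite expn0 muln1.
have [||i [l [i0 qi E]]] := IH (j %/ q)%N.
- exact: ltn_Pdiv.
- by rewrite divn_gt0 ?(ltnW q1)// dvdn_leq.
by exists i, l.+1; split=> //; rewrite expnSr mulnA -E divnK.
Qed.

Lemma qadic_inj (q i i' l l' : nat) : (1 < q)%N -> ~~ (q %| i)%N ->
  ~~ (q %| i')%N -> (i * q ^ l = i' * q ^ l')%N -> i = i' /\ l = l'.
Proof.
move=> q1; wlog ll' : i i' l l' / (l <= l')%N => [hwlog|].
  move=> qi qi' E; have [/hwlog|/ltnW/hwlog] := leqP l l'; first exact.
  by move=> /(_ i' i qi' qi (esym E))[-> ->].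
move=> qi qi'; rewrite -(subnK ll') expnD mulnA => /eqP.
rewrite eqn_pmul2r ?expn_gt0 ?(ltnW q1)// => /eqP E.
case D : (l' - l)%N E => [|e] E; last first.
  by move: qi; rewrite E expnS mulnCA dvdn_mulr.
by rewrite E expn0 muln1.
Qed.

Definition fiber (d : nat) (m : nat -> nat) (q i : nat) (x : Sigma d m) :
  Sigma d m := fun l : nat => x (i * q ^ l)%N.-1.

(** Each position is i q^l for exactly one pair (i, l) with q not dividing i, so
    the fibres of a point of X_Omega can be prescribed independently. *)
Lemma X_of_fibers (d : nat) (m : nat -> nat) (q : nat) (Omega : set (Sigma d m))
    (z : nat -> Sigma d m) : (1 < q)%N -> (forall i, Omega (z i)) ->
  exists2 x, X_ q Omega x &
    forall i, (0 < i)%N -> ~~ (q %| i)%N -> fiber q i x = z i.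
Proof.
move=> q1 zO.
(* The letter at position j.+1 = i q^l is forced to be the l-th letter of z i. *)
have letter (j : nat) : exists y : forall k : 'I_d, 'I_(m k.+1),
    forall i l, (0 < i)%N -> ~~ (q %| i)%N -> j.+1 = (i * q ^ l)%N ->
    y = z i l.
  have [i [l [i0 qi E]]] := qadic_ex q1 (ltn0Sn j).
  exists (z i l) => i' l' _ qi' E'.
  by have [-> ->] := qadic_inj q1 qi qi' (etrans (esym E) E').
have [x xP] := choice letter.
have fx i : (0 < i)%N -> ~~ (q %| i)%N -> fiber q i x = z i.
  move=> i0 qi; apply/funext => l; apply: xP => //.
  by rewrite prednK// muln_gt0 i0 expn_gt0 (ltnW q1).
exists x => // i i0 qi.
by have := zO i; rewrite -(fx i i0 qi).
Qed.

Definition fiber_lengths (d q : nat) (ell : nat -> nat) (i : nat)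
  (k : 'I_d) : nat := count_powers q (ell k.+1) i.

(** Multiples of q carry no progression of their own.  Giving them empty windows
    lets the table below be indexed by all of 'I_T. *)
Definition fiber_window (d q : nat) (ell : nat -> nat) (i : nat) :
    'I_d -> nat :=
  if (q %| i)%N then fun=> 0%N else fiber_lengths q ell i.

Definition fiber_table (d : nat) (m : nat -> nat) (q : nat) (ell : nat -> nat)
    (T : nat) (x : Sigma d m) :
    {dffun forall j : 'I_T, window m (@fiber_window d q ell j.+1)} :=
  [ffun j : 'I_T => restr (fiber_window q ell j.+1) (fiber q j.+1 x)].

Lemma fiber_tableP (d : nat) (m : nat -> nat) (q : nat) (ell : nat -> nat)
    (T : nat) (x u : Sigma d m) : (1 < q)%N ->
  (forall k : 'I_d, (ell k.+1 <= T)%N) ->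
  fiber_table q ell T x = fiber_table q ell T u <->
  forall (k : 'I_d) (l : nat), (l < ell k.+1)%N -> x l k = u l k.
Proof.
move=> q1 ellT; split=> [xu k l lk|xu].
  have [i [e [i0 qi E]]] := qadic_ex q1 (ltn0Sn l).
  have iT : (i.-1 < T)%N.
    rewrite prednK//; apply: leq_trans (ellT k); apply: leq_trans lk.
    by rewrite E leq_pmulr// expn_gt0 (ltnW q1).
  have /ffunP/(_ (Ordinal iT)) := xu; rewrite !ffunE.
  move=> /restrP/(_ k e); rewrite /= prednK// /fiber -E /=; apply.
  by rewrite /fiber_window (negbTE qi) ltn_count_powers// -E.
apply/ffunP => j; rewrite !ffunE; apply/restrP => k l.
rewrite /fiber_window; case: ifP => // _; rewrite ltn_count_powers// => jl.
apply: xu; rewrite prednK// muln_gt0 expn_gt0 (ltnW q1)//.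
Qed.

Lemma patterns_empty (d : nat) (m : nat -> nat) (Omega : set (Sigma d m)) :
  Omega !=set0 -> patterns Omega (fun=> 0%N) = 1%N.
Proof.
move=> O0; apply/eqP; rewrite eqn_leq nvalues_gt0// andbT.
apply: leq_trans (max_card _) _; rewrite card_dep_ffun foldrE big_map big_enum.
by rewrite big1//= => k _; rewrite card_ffun !card_ord.
Qed.

(** The progressions are independent, and those of the multiples of q only
    contribute factors 1. *)
Lemma nvalues_fiber_table (d : nat) (m : nat -> nat) (q : nat)
    (ell : nat -> nat) (T : nat) (Omega : set (Sigma d m)) : (1 < q)%N ->
  Omega !=set0 ->
  nvalues (@fiber_table d m q ell T) (X_ q Omega) =
  (\prod_(1 <= i < T.+1 | ~~ (q %| i)%N)
     patterns Omega (fiber_lengths q ell i))%N.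
Proof.
move=> q1 O0.
rewrite big_add1 /= big_mkord big_mkcond /=.
transitivity (\prod_(j < T) patterns Omega (fiber_window q ell j.+1))%N;
    last first.
  apply: eq_bigr => j _; rewrite /fiber_window; case: ifP => //= _.
  exact: patterns_empty.
apply: (nvalues_family (B := fun=> Omega)
  (f := fun j x => restr (fiber_window q ell j.+1) (fiber q j.+1 x))
  (g := fun j => @restr d m (fiber_window q ell j.+1))) => [x Xx j|z zO].
  have [qj|qj] := boolP (q %| j.+1)%N; last first.
    by exists (fiber q j.+1 x) => //; exact: Xx.
  have [z zO] := O0; exists z => //.
  by apply/restrP => k l; rewrite /fiber_window qj.
have [z0 z0O] := O0.
have [|x Xx fx] := @X_of_fibers d m q Omega
  (fun i => if insub i.-1 is Some j then z j else z0) q1.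
  by move=> i; case: insubP.
exists x => // j; apply/restrP => k l; rewrite /fiber_window.
by case: ifPn => // qj _; rewrite fx//= valK.
Qed.

(** * Observation lengths and covering numbers *)

(** The product gamma_{k+1} ... gamma_d, which telescopes to
    log m_d / log m_k; it is the limit of ell_k / ell_d. *)
Definition log_ratio (R : realType) (d : nat) (m : nat -> nat) (k : nat) : R :=
  \prod_(k.+1 <= i < d.+1) gamma R m i.

Definition alphabets (d : nat) (m : nat -> nat) : Prop :=
  (forall k, (1 <= k <= d.-1)%N -> (m k.+1 <= m k)%N) /\ (2 <= m d)%N.

Lemma alphabet_le (d : nat) (m : nat -> nat) (j k : nat) : alphabets d m ->
  (1 <= j)%N -> (j <= k)%N -> (k <= d)%N -> (m k <= m j)%N.
Proof.
move=> [hm _] j1; elim: k => [|k IH]; first by case: j j1.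
rewrite leq_eqVlt => /predU1P[->//|jk] kd.
by apply: leq_trans (hm k _) (IH jk (ltnW kd)); lia.
Qed.

Lemma alphabet_ge2 (d : nat) (m : nat -> nat) (k : nat) : alphabets d m ->
  (1 <= k <= d)%N -> (2 <= m k)%N.
Proof.
move=> hm /andP[k1 kd]; apply: leq_trans (alphabet_le hm k1 kd (leqnn d)).
by case: hm.
Qed.

Lemma ln_alphabet_gt0 (R : realType) (d : nat) (m : nat -> nat) (k : nat) :
  alphabets d m -> (1 <= k <= d)%N -> 0 < ln (m k)%:R :> R.
Proof. by move=> hm kd; rewrite ln_gt0// ltr1n; apply: (alphabet_ge2 hm). Qed.

Lemma gamma_bounds (R : realType) (d : nat) (m : nat -> nat) (i : nat) :
  alphabets d m -> (2 <= i <= d)%N -> 0 < gamma R m i <= 1.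
Proof.
move=> hm /andP[i2 id'].
have i1 : (1 <= i.-1 <= d)%N by lia.
rewrite divr_gt0 ?(ln_alphabet_gt0 _ hm)//=; last by lia.
rewrite ler_pdivrMr ?(ln_alphabet_gt0 _ hm)// mul1r ler_ln ?posrE ?ltr0n.
- by rewrite ler_nat; apply: (alphabet_le hm); lia.
- by apply: leq_trans (alphabet_ge2 hm _); lia.
- by apply: leq_trans (alphabet_ge2 hm i1).
Qed.

Lemma absz_ceil (R : realType) (x : R) : 0 <= x ->
  (`|Num.ceil x|%N%:R : R) = (Num.ceil x)%:~R.
Proof.
move=> x0; rewrite natr_absz ger0_norm// ceil_ge0.
by rewrite (lt_le_trans _ x0)// ltrN10.
Qed.

Lemma absz_ceil_le (R : realType) (x : R) (j : nat) : 0 <= x ->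
  (`|Num.ceil x|%N <= j)%N = (x <= j%:R).
Proof.
move=> x0; rewrite -(ler_nat R) absz_ceil// -[j%:R]/(j%:Z%:~R) ler_int.
by rewrite ceil_le_int.
Qed.

Lemma L_bounds (R : realType) (d : nat) (m : nat -> nat) (i n : nat) :
  alphabets d m -> (2 <= i <= d)%N ->
  n%:R <= gamma R m i * (L_ R m i n)%:R <= n%:R + 1.
Proof.
move=> hm hi; have /andP[g0 g1] := gamma_bounds R hm hi.
rewrite /L_ ifF; last by lia.
have x0 : 0 <= n%:R / gamma R m i by rewrite divr_ge0// ltW.
rewrite absz_ceil//; have /andP[] := ceil_itv (n%:R / gamma R m i).
rewrite intrB ltr_pdivlMr// ler_pdivrMr// => lt le.
rewrite mulrC le/=.
set c := (Num.ceil _)%:~R in lt le *.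
nra.
Qed.

Lemma L_mono (R : realType) (m : nat -> nat) (i n n' : nat) :
  0 <= gamma R m i -> (n <= n')%N -> (L_ R m i n <= L_ R m i n')%N.
Proof.
move=> g0 nn'; rewrite /L_; case: ifP => // _.
have x0 j : 0 <= j%:R / gamma R m i by rewrite divr_ge0.
rewrite absz_ceil_le// absz_ceil//; apply: (le_trans _ (ceil_ge _)).
by rewrite ler_wpM2r ?invr_ge0// ler_nat.
Qed.

Lemma Lcomp1 (R : realType) (m : nat -> nat) (n : nat) : Lcomp R m 1 n = n.
Proof. by []. Qed.

Lemma Lcomp_mono (R : realType) (d : nat) (m : nat -> nat) (k n n' : nat) :
  alphabets d m -> (k <= d)%N -> (n <= n')%N ->
  (Lcomp R m k n <= Lcomp R m k n')%N.
Proof.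
move=> hm; elim: k => [//|[|k] IH] kd nn'; first by [].
by apply: L_mono; [have /andP[/ltW] := gamma_bounds R hm (i := k.+2) kd |
  exact: IH (ltnW kd) nn'].
Qed.

Lemma Lcomp_le (R : realType) (d : nat) (m : nat -> nat) (k k' n : nat) :
  alphabets d m -> (1 <= k)%N -> (k <= k')%N -> (k' <= d)%N ->
  (Lcomp R m k n <= Lcomp R m k' n)%N.
Proof.
move=> hm k1; elim: k' => [|k' IH]; first by case: k k1.
rewrite leq_eqVlt => /predU1P[->//|kk'] kd.
apply: leq_trans (IH kk' (ltnW kd)) _ => /=.
have hk : (2 <= k'.+1 <= d)%N by lia.
have /andP[h _] := L_bounds R (Lcomp R m k' n) hm hk.
have /andP[g0 g1] := gamma_bounds R hm hk.
rewrite -(ler_nat R); apply: le_trans h _.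
by rewrite ler_piMl.
Qed.

Lemma log_ratioS (R : realType) (d : nat) (m : nat -> nat) (k : nat) :
  (k < d)%N -> log_ratio R d m k = gamma R m k.+1 * log_ratio R d m k.+1.
Proof. by move=> kd; rewrite /log_ratio big_ltn. Qed.

Lemma log_ratio_bounds (R : realType) (d : nat) (m : nat -> nat) (k : nat) :
  alphabets d m -> (1 <= k)%N -> 0 < log_ratio R d m k <= 1.
Proof.
move=> hm k1; rewrite /log_ratio big_nat_cond.
apply: (big_ind (fun x : R => 0 < x <= 1)) => [|x y /andP[x0 x1] /andP[y0 y1]|i hi].
- by rewrite ltr01 lexx.
- by rewrite mulr_gt0// mulr_ile1// ltW.
- by apply: (gamma_bounds _ hm); lia.
Qed.

Lemma log_ratio1 (R : realType) (d : nat) (m : nat -> nat) : alphabets d m ->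
  (1 <= d)%N -> log_ratio R d m 1 = ln (m d)%:R / ln (m 1)%:R.
Proof.
move=> hm d1; rewrite /log_ratio.
suff H e : (1 <= e <= d)%N ->
    \prod_(2 <= i < e.+1) gamma R m i = ln (m e)%:R / ln (m 1%N)%:R :> R.
  by apply: H; rewrite d1 leqnn.
elim: e => // -[_ _|e IH he].
  by rewrite big_geq// divff// gt_eqF// (ln_alphabet_gt0 _ hm).
rewrite big_nat_recr//= IH; last by lia.
rewrite /gamma/= mulrC mulrA divfK// gt_eqF// (ln_alphabet_gt0 _ hm)//; lia.
Qed.

(** Each ceiling in ell_{k+1} = ceil (ell_k / gamma_{k+1}) costs at most 1, and
    as the gamma are at most 1 these errors are not amplified on the way down
    from ell_d to ell_k. *)
Lemma Lcomp_gap (R : realType) (d : nat) (m : nat -> nat) (k n : nat) :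
  alphabets d m -> (1 <= k <= d)%N ->
  (Lcomp R m k n)%:R <= log_ratio R d m k * (Lcomp R m d n)%:R
    <= (Lcomp R m k n)%:R + d%:R.
Proof.
move=> hm /andP[k1 kd].
suff H e : (e < d)%N -> (Lcomp R m (d - e) n)%:R <=
    log_ratio R d m (d - e) * (Lcomp R m d n)%:R
    <= (Lcomp R m (d - e) n)%:R + e%:R.
  have /andP[h1 h2] := H (d - k)%N ltac:(lia).
  rewrite subKn// in h1 h2; rewrite h1/=; apply: le_trans h2 _.
  by rewrite lerD2l ler_nat leq_subr.
elim: e => [_|e IH ed].
  by rewrite subn0 /log_ratio big_geq// mul1r addr0 lexx.
have /andP[h1 h2] := IH (ltnW ed).
have E : (d - e = (d - e.+1).+1)%N by lia.
rewrite log_ratioS; last by lia.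
rewrite E in h1 h2.
set k' := (d - e.+1)%N in h1 h2 *.
have hk : (2 <= k'.+1 <= d)%N by lia.
have /andP[l1 l2] := L_bounds R (Lcomp R m k' n) hm hk.
have /andP[g0 g1] := gamma_bounds R hm hk.
rewrite -mulrA; rewrite -/(Lcomp R m k'.+1 n) in l1 l2.
apply/andP; split.
  by apply: le_trans l1 _; rewrite ler_pM2l.
rewrite -natr1 addrA.
apply: le_trans (_ : gamma R m k'.+1 * ((Lcomp R m k'.+1 n)%:R + e%:R) <= _).
  by rewrite ler_pM2l.
have := ler0n R e; nra.
Qed.

Lemma first_alphabet_gt1 (d : nat) (m : nat -> nat) (R : realType) :
  alphabets d m -> (1 <= d)%N -> 1 < (m 1%N)%:R :> R.
Proof. by move=> hm d1; rewrite ltr1n (alphabet_ge2 hm). Qed.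

(** The index n of the ball B_n which is the ball of radius r: the least n with
    m_1^(-n) <= r. *)
Definition ball_index (R : realType) (m : nat -> nat) (r : R) : nat :=
  `|Num.ceil (Num.max 0 (ln r^-1 / ln (m 1%N)%:R))%R|%N.

Lemma ball_index_le (R : realType) (m : nat -> nat) (r : R) (j : nat) :
  (ball_index m r <= j)%N = (ln r^-1 / ln (m 1%N)%:R <= j%:R).
Proof. by rewrite /ball_index absz_ceil_le ?le_max ?lexx// ge_max ler0n. Qed.

Lemma B_anti (R : realType) (d : nat) (m : nat -> nat) (n n' : nat)
    (x u : Sigma d m) : alphabets d m -> (n <= n')%N ->
  B_ R n' x u -> B_ R n x u.
Proof.
move=> hm nn' xu k i ik; apply: xu; apply: leq_trans ik _.
exact: (Lcomp_mono _ hm).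
Qed.

(** The set of n with u in B_n(x) is an initial segment of the integers.  It is
    either everything, and the distance is 0, or it has a largest element M, and
    the distance is m_1^(-M). *)
Lemma dist_le (R : realType) (d : nat) (m : nat -> nat) (r : R)
    (x u : Sigma d m) : alphabets d m -> (1 <= d)%N -> 0 < r ->
  dist R x u <= r <-> B_ R (ball_index m r) x u.
Proof.
move=> hm d1 r0; have m1 := first_alphabet_gt1 R hm d1; have lnm := ln_gt0 m1.
rewrite /dist; set S := [set n | B_ R n x u].
have S0 : S 0%N.
  move=> k i; suff -> : Lcomp R m k.+1 0 = 0%N by [].
  elim: (nat_of_ord k) => // e IH; rewrite [LHS]/(L_ R m e.+2 (Lcomp R m e.+1 0)) IH.
  by rewrite /L_/= mul0r ceil0.
have [all|/existsNP[j0 Sj0]] := pselect (forall j, S j).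
  rewrite (_ : ereal_sup _ = +oo%E).
    by split=> _; [exact: all|exact: ltW].
  apply/eq_infty => a; pose j := Num.truncn (Num.max 0 a).
  apply: (@le_trans _ _ (j.+1%:R)%:E).
    rewrite lee_fin; apply/ltW; apply: (@le_lt_trans _ _ (Num.max 0 a)).
      by rewrite le_max lexx orbT.
    by have /andP[] := @truncn_itv _ (Num.max 0 a) ltac:(by rewrite le_max lexx).
  by apply: ereal_sup_ubound; exists j.+1.
(* The initial segment ends at the least j outside of it, so M = j.-1. *)
have exj : exists j, ~~ `[< S j >] by exists j0; apply/asboolP.
case: (ex_minnP exj) => j /asboolPn Sj jmin.
have SP n : S n <-> (n < j)%N.
  split=> [Sn|nj].
    by rewrite ltnNge; apply/negP => jn; apply/Sj/(B_anti hm jn).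
  by apply: contrapT => Sn; move: nj; rewrite ltnNge jmin//; apply/asboolPn.
have j1 : (0 < j)%N by apply/SP.
have -> : ereal_sup [set n%:R%:E | n in S] = (j.-1%:R)%:E :> \bar R.
  apply/eqP; rewrite eq_le; apply/andP; split.
    apply: ge_ereal_sup => _ [n /SP nj <-]; rewrite lee_fin ler_nat; lia.
  by apply: ereal_sup_ubound; exists j.-1 => //; apply/SP; lia.
rewrite -[X in _ <-> X]/(S (ball_index m r)) SP -(prednK j1) ltnS ball_index_le.
rewrite lnV ?posrE// ler_pdivrMr// lerNl -mulNr -ln_powR.
by rewrite ler_ln ?posrE ?powR_gt0// (lt_trans ltr01).
Qed.

(** The arguments are ordered so that [ball_length R m n] is the sequence of
    observation lengths of the balls B_n. *)
Definition ball_length (R : realType) (m : nat -> nat) (n k : nat) : nat :=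
  Lcomp R m k n.

Lemma covering_number_X (R : realType) (d q : nat) (m : nat -> nat)
    (Omega : set (Sigma d m)) (r : R) : alphabets d m -> (1 <= d)%N ->
  (1 < q)%N -> Omega !=set0 -> 0 < r ->
  is_covering_number (@dist R d m) (X_ q Omega) r
    (\prod_(1 <= i < (ball_length R m (ball_index m r) d).+1 | ~~ (q %| i)%N)
       patterns Omega (fiber_lengths q (ball_length R m (ball_index m r)) i))%N.
Proof.
move=> hm d1 q1 O0 r0; rewrite -nvalues_fiber_table//.
apply: nvalues_covering => x u; rewrite dist_le// fiber_tableP//.
by move=> k; rewrite /ball_length; apply: (Lcomp_le _ _ hm).
Qed.

(** * Dominated convergence for series *)

Lemma cvgr_dist_le (R : realType) (f : nat -> R) (a c e : R) :
  f @ \oo --> a -> (\forall n \near \oo, `|f n - c| <= e) -> `|a - c| <= e.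
Proof.
move=> fa fe; apply: (@cvgr_to_le _ _ _ _ (fun n => `|f n - c|) _ _ _ fe).
by apply: cvg_norm; apply: cvgB fa _; exact: cvg_cst.
Qed.

Lemma series_tail_le (R : realType) (M : nat -> R) (e : R) :
  (forall r, 0 <= M r) -> cvgn (series M) -> 0 < e ->
  exists N, forall N', \sum_(N <= r < N') M r <= e.
Proof.
move=> M0 cM e0.
have nd : nondecreasing_seq (series M).
  by apply/nondecreasing_seqP => n; rewrite /series/= big_nat_recr//= lerDl.
have /cvgrPdist_le/(_ _ e0)[N _ /(_ N (leqnn N))] := cM.
move=> HN; exists N => N'.
have [NN'|/ltnW N'N] := leqP N N'; last by rewrite big_geq// ltW.
rewrite -(sub_series_geq _ NN').
by apply: le_trans (le_trans (ler_norm _) HN); rewrite /= lerD2r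
  nondecreasing_cvgn_le.
Qed.

Lemma cvg_sum_nat (R : realType) (u : nat -> nat -> R) (l : nat -> R)
    (a b : nat) : (forall r, (a <= r < b)%N -> (u ^~ r) @ \oo --> l r) ->
  (fun n => \sum_(a <= r < b) u n r) @ \oo --> \sum_(a <= r < b) l r.
Proof.
have [ba _|/ltnW/subnK <-] := leqP b a.
  by rewrite big_geq//; under eq_fun do rewrite big_geq//; exact: cvg_cst.
elim: (b - a)%N => [_|c IH ul].
  by rewrite big_geq//; under eq_fun do rewrite big_geq//; exact: cvg_cst.
rewrite addSn big_nat_recr ?leq_addl//=.
under eq_fun do rewrite big_nat_recr ?leq_addl//=.
apply: cvgD; last by apply: ul; rewrite leq_addl addSn ltnS leqnn.
by apply: IH => r /andP[ar rc]; apply: ul; rewrite ar addSn ltnS ltnW.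
Qed.

(** Dominated convergence for series.  The last hypothesis makes each sum over r
    finite; beyond a rank independent of n, both the sums and the series of
    limits are below the tail of the dominating series. *)
Lemma tannery (R : realType) (u : nat -> nat -> R) (M l : nat -> R)
    (N : nat -> nat) :
  (forall n r, `|u n r| <= M r) -> cvgn (series M) ->
  (forall r, (u ^~ r) @ \oo --> l r) ->
  (forall n r, (N n <= r)%N -> u n r = 0) ->
  cvgn (series l) /\
  (fun n => \sum_(0 <= r < N n) u n r) @ \oo --> limn (series l).
Proof.
move=> uM cM ul u0.
have M0 r : 0 <= M r by apply: le_trans (uM 0%N r).
have lM r : `|l r| <= M r.
  rewrite -[l r]subr0; apply: cvgr_dist_le (ul r) _.
  by near=> n; rewrite subr0.
have cl : cvgn (series l).
  by apply: normed_cvg; apply: series_le_cvg cM => // r; exact: normr_ge0.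
split=> //; apply/cvgrPdist_le => e e0.
have e3 : 0 < e / 3 by rewrite divr_gt0.
have [R0 tail] := series_tail_le M0 cM e3.
have ltail : `|limn (series l) - series l R0| <= e / 3.
  apply: cvgr_dist_le (cl) _; near=> n.
  rewrite [X in `|X|](_ : _ = \sum_(R0 <= r < n) l r); last first.
    by rewrite -sub_series_geq//; near: n; exists R0.
  apply: le_trans (tail n); apply: le_trans (ler_norm_sum _ _ _) _.
  by apply: ler_sum => r _.
have /cvgrPdist_le/(_ _ e3) head : (fun n => \sum_(0 <= r < R0) u n r) @ \oo
    --> series l R0 by apply: cvg_sum_nat => r _; exact: ul.
near=> n.
have h1 : `|series l R0 - \sum_(0 <= r < R0) u n r| <= e / 3.
  by near: n; exact: head.
have -> : \sum_(0 <= r < N n) u n r =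
    \sum_(0 <= r < R0) u n r + \sum_(R0 <= r < maxn (N n) R0) u n r.
  rewrite -big_cat_nat ?leq_maxr//= (@big_cat_nat _ _ _ (N n) 0%N (maxn _ _))
    ?leq_maxl//=.
  rewrite [X in _ = _ + X]big1_seq ?addr0// => r /andP[_].
  by rewrite mem_index_iota => /andP[/u0].
have utail : `|\sum_(R0 <= r < maxn (N n) R0) u n r| <= e / 3.
  apply: le_trans (tail (maxn (N n) R0)); apply: le_trans (ler_norm_sum _ _ _) _.
  by apply: ler_sum => r _.
set a := limn _ in ltail *; set b := series l R0 in h1 ltail.
set c := bigop _ _ _ in h1 *; set t := bigop _ _ _ in utail *.
rewrite (_ : a - (c + t) = (a - b) + (b - c) - t); last by ring.
rewrite (_ : e = e / 3 + e / 3 + e / 3); last by field.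
by apply: le_trans (ler_normB _ _) _; rewrite lerD//;
  apply: le_trans (ler_normD _ _) _; rewrite lerD.
Unshelve. all: by end_near. Qed.

(** * Sums of step functions over the integers that q does not divide *)

Lemma count_nondivisible (q b : nat) : (0 < q)%N ->
  (\sum_(1 <= i < b.+1 | ~~ (q %| i)) 1 + b %/ q = b)%N.
Proof.
move=> q0; rewrite big_mkcond; elim: b => [|b IH]; first by rewrite big_geq// div0n.
rewrite big_nat_recr//= divnS//.
set s := bigop _ _ _ in IH *.
by case: (q %| b.+1)%N; rewrite /= -?[X in (_ = X.+1)%N]IH; lia.
Qed.

Lemma count_nondivisible_approx (R : realType) (q a b : nat) : (0 < q)%N ->
  (a <= b)%N ->
  `|\sum_(a.+1 <= i < b.+1 | ~~ (q %| i)%N) 1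
     - (b%:R - a%:R) * (1 - q%:R^-1)| <= 1 :> R.
Proof.
move=> q0 ab.
have Eb := count_nondivisible b q0; have Ea := count_nondivisible a q0.
rewrite (@big_cat_nat _ _ _ a.+1)//= in Eb.
have {Ea Eb} E : (\sum_(a.+1 <= i < b.+1 | ~~ (q %| i)) 1 + a + b %/ q =
  a %/ q + b)%N.
  move: Ea Eb; set u := bigop _ _ _; set v := bigop _ _ _; lia.
have {E} : (\sum_(a.+1 <= i < b.+1 | ~~ (q %| i)) 1 + a + b %/ q)%N%:R =
  (a %/ q + b)%N%:R :> R by rewrite E.
rewrite !natrD natr_sum.
have dv c : exists2 e : R, 0 <= e <= 1 & c%:R * q%:R^-1 = (c %/ q)%N%:R + e.
  exists ((c %% q)%N%:R / q%:R).
    rewrite divr_ge0//= ler_pdivrMr ?ltr0n// mul1r ler_nat ltnW//.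
    by rewrite ltn_mod.
  rewrite {1}(divn_eq c q) natrD natrM mulrDl mulfK// pnatr_eq0; lia.
have [ea ea1 Ea] := dv a; have [eb eb1 Eb] := dv b.
set s := bigop _ _ _ => H.
rewrite (_ : s - _ = eb - ea); last first.
  by rewrite mulrBr mulr1 mulrBl Ea Eb; lra.
by rewrite ler_norml; lra.
Qed.

Lemma sum_norm_le (R : realType) (P : pred nat) (f : nat -> R) (D : R)
    (a b : nat) : 0 <= D -> (a <= b)%N ->
  (forall i, (a <= i < b)%N -> `|f i| <= D) ->
  `|\sum_(a <= i < b | P i) f i| <= D * (b%:R - a%:R).
Proof.
move=> D0 ab fD; apply: le_trans (ler_norm_sum _ _ _) _.
apply: (@le_trans _ _ (\sum_(a <= i < b) D)).
  rewrite big_mkcond/=; apply: ler_sum_nat => i hi.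
  by case: ifP => // _; exact: fD.
by rewrite big_const_nat iter_addr addr0 -natrB// mulr_natr.
Qed.

(** Removing up to K integers at each end of an interval leaves only integers at
    distance at least K from both ends; A' = B' covers the case of an interval
    that is too short. *)
Lemma trim_interval (A B K : nat) : (A <= B)%N ->
  exists A' B', [/\ (A <= A' <= A + K)%N, (A' <= B' <= B)%N,
    (B <= B' + K)%N & forall i, (A' < i <= B')%N -> (A + K < i)%N /\ (i + K <= B)%N].
Proof.
move=> AB; exists (minn (A + K) B), (maxn (minn (A + K) B) (B - K)).
by split=> [|||i hi]; [lia..|split; lia].
Qed.

(** At most 2K indices lie within K of an end of the interval, and the others
    contribute nothing. *)
Lemma sum_near_ends_le (R : realType) (P : pred nat) (f : nat -> R) (D : R)
    (A B K : nat) : 0 <= D -> (A <= B)%N ->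
  (forall i, (A < i <= B)%N -> `|f i| <= D) ->
  (forall i, (A + K < i)%N -> (i + K <= B)%N -> f i = 0) ->
  `|\sum_(A.+1 <= i < B.+1 | P i) f i| <= D * (2 * K%:R).
Proof.
move=> D0 AB fD f0.
have [A' [B' [/andP[AA' A'K] /andP[A'B' B'B] B'K mid]]] := trim_interval K AB.
rewrite (@big_cat_nat _ _ _ A'.+1)//=; last by rewrite ltnS (leq_trans A'B').
rewrite (@big_cat_nat _ _ _ B'.+1 A'.+1)//= [X in _ + (X + _)]big1_seq; last first.
  by move=> i /andP[_]; rewrite mem_index_iota => /mid[]; exact: f0.
have piece a b : (a <= b)%N -> (b <= a + K)%N -> (A <= a)%N -> (b <= B)%N ->
    `|\sum_(a.+1 <= i < b.+1 | P i) f i| <= D * K%:R.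
  move=> ab baK Aa bB; apply: le_trans (_ : D * (b.+1%:R - a.+1%:R) <= _).
    apply: sum_norm_le => // i /andP[ai ib]; apply: fD.
    by rewrite (leq_ltn_trans Aa)//= (leq_trans _ bB).
  by rewrite ler_wpM2l// -natrB// ler_nat subSS leq_subLR.
rewrite add0r mulrCA mulr_natl mulr2n; apply: le_trans (ler_normD _ _) _.
apply: lerD; apply: piece => //; first exact: leq_trans A'B' B'B.
exact: leq_trans A'B'.
Qed.

(** If w is equal to c on the interval except near its ends, its sum over the
    integers that q does not divide is the density 1 - 1/q times the integral of
    c, with an error which depends neither on the interval nor on w except
    through C and K. *)
Lemma step_interval (R : realType) (q K : nat) (w : nat -> R)
    (alpha beta c C : R) : (0 < q)%N -> 0 <= alpha -> alpha <= beta ->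
  `|c| <= C ->
  (forall i, (Num.truncn alpha < i <= Num.truncn beta)%N -> `|w i| <= C) ->
  (forall i, (0 < i)%N -> alpha + K%:R <= i%:R -> i%:R + K%:R <= beta ->
     w i = c) ->
  `|\sum_((Num.truncn alpha).+1 <= i < (Num.truncn beta).+1 | ~~ (q %| i)%N) w i
     - (1 - q%:R^-1) * (c * (beta - alpha))| <= C * (4 * K%:R + 3).
Proof.
move=> q0 a0 ab cC wC wc; have b0 := le_trans a0 ab.
have C0 : 0 <= C by apply: le_trans cC.
have /andP[A1 A2] := truncn_itv a0; have /andP[B1 B2] := truncn_itv b0.
have AB := le_truncn ab.
set A := Num.truncn alpha in wC A1 A2 AB *.
set B := Num.truncn beta in wC B1 B2 AB *.
(* The error has three sources: the indices where w is not c, the count of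
   non-multiples of q, and the rounding of alpha and beta. *)
have q1 : 0 <= 1 - (q%:R : R)^-1 <= 1.
  rewrite subr_ge0 invf_le1 ?ler1n ?ltr0n// q0/= gerBl invr_ge0//.
have E : \sum_(A.+1 <= i < B.+1 | ~~ (q %| i)%N) w i =
   c * \sum_(A.+1 <= i < B.+1 | ~~ (q %| i)%N) 1 +
   \sum_(A.+1 <= i < B.+1 | ~~ (q %| i)%N) (w i - c).
  rewrite big_distrr/= -big_split/=; apply: eq_bigr => i _.
  by rewrite mulr1 addrC subrK.
have bad : `|\sum_(A.+1 <= i < B.+1 | ~~ (q %| i)%N) (w i - c)|
    <= (2 * C) * (2 * K%:R).
  apply: sum_near_ends_le => // [|i hi|i Ki iK].
  - by rewrite mulr_ge0.
  - apply: le_trans (ler_normB _ _) _.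
    by rewrite mulr_natl mulr2n lerD// wC.
  - rewrite wc ?subrr//; first exact: leq_ltn_trans Ki.
    + apply: le_trans (_ : (A + K).+1%:R <= _); last by rewrite ler_nat.
      by rewrite -addSn natrD lerD2r ltW.
    + by apply: le_trans B1; rewrite -natrD ler_nat.
rewrite E; have := @count_nondivisible_approx R q A B q0 AB.
set s := bigop _ _ _ => sP; set t := bigop _ _ _ in bad *.
set Q := 1 - _ in q1 sP *.
rewrite (_ : c * s + t - _ = c * (s - (B%:R - A%:R) * Q) + t
  + c * (Q * ((B%:R - A%:R) - (beta - alpha)))); last by ring.
have h3 : `|Q * ((B%:R - A%:R) - (beta - alpha))| <= 2.
  rewrite normrM (ger0_norm (proj1 (andP q1))).
  have : `|B%:R - A%:R - (beta - alpha)| <= 2 by rewrite ler_norml -?natr1; lra.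
  move: (normr_ge0 (B%:R - A%:R - (beta - alpha))); nra.
have h1 : `|c * (s - (B%:R - A%:R) * Q)| <= C * 1.
  by rewrite normrM ler_pM.
have h4 : `|c * (Q * ((B%:R - A%:R) - (beta - alpha)))| <= C * 2.
  by rewrite normrM ler_pM.
apply: le_trans (ler_normD _ _) _.
apply: le_trans (lerD (ler_normD _ _) (lexx _)) _; lra.
Qed.

(** The same estimate for a step function with the steps [b t, b t.+1]. *)
Lemma step_sum (R : realType) (q K : nat) (w : nat -> R)
    (b v : nat -> R) (C : R) (s e : nat) : (0 < q)%N -> (s <= e)%N ->
  (forall t, (s <= t <= e)%N -> 0 <= b t) ->
  (forall t, (s <= t < e)%N -> b t <= b t.+1) ->
  (forall t, (s <= t < e)%N -> `|v t| <= C) ->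
  (forall i, (Num.truncn (b s) < i <= Num.truncn (b e))%N -> `|w i| <= C) ->
  (forall t i, (s <= t < e)%N -> (0 < i)%N -> b t + K%:R <= i%:R ->
     i%:R + K%:R <= b t.+1 -> w i = v t) ->
  `|\sum_((Num.truncn (b s)).+1 <= i < (Num.truncn (b e)).+1 | ~~ (q %| i)%N) w i
     - (1 - q%:R^-1) * \sum_(s <= t < e) v t * (b t.+1 - b t)|
   <= (e - s)%N%:R * (C * (4 * K%:R + 3)).
Proof.
move=> q0; elim: e => [|e IH] se b0 bm vC wC wv.
  have -> : s = 0%N by lia.
  by rewrite !big_geq// mulr0 subrr normr0 mul0r.
have [{IH} es|{}se] : (s = e.+1)%N \/ (s <= e)%N by lia.
  by rewrite es !big_geq// mulr0 subrr normr0 subnn mul0r.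
have mono t t' : (s <= t)%N -> (t <= t')%N -> (t' <= e.+1)%N -> b t <= b t'.
  move=> st; elim: t' => [|t' IHt tt' te]; first by case: t st => // ?.
  have [->//|{}tt'] : t = t'.+1 \/ (t <= t')%N by lia.
  by apply: le_trans (IHt tt' (ltnW te)) (bm _ _); lia.
have T1 : (Num.truncn (b s) <= Num.truncn (b e))%N.
  by apply: le_truncn; apply: mono.
have T2 : (Num.truncn (b e) <= Num.truncn (b e.+1))%N.
  by apply: le_truncn; apply: mono; lia.
rewrite (@big_cat_nat _ _ _ (Num.truncn (b e)).+1)//=.
rewrite [X in _ * X]big_nat_recr//= mulrDr opprD addrACA subSn// mulrSr.
rewrite [leRHS]mulrDl mul1r.
apply: le_trans (ler_normD _ _) _; apply: lerD.
  apply: IH => // [t ht|t ht|t ht|i hi|t i ht].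
  - by apply: b0; lia.
  - by apply: bm; lia.
  - by apply: vC; lia.
  - by apply: wC; lia.
  - by apply: wv; lia.
apply: step_interval => //.
- by apply: b0; lia.
- by apply: bm; lia.
- by apply: vC; lia.
- by move=> i hi; apply: wC; lia.
- by move=> i; apply: wv; lia.
Qed.

(** * The shapes seen at each level *)

Section Levels.
Context (R : realType) (d q : nat) (m p : nat -> nat)
  (sigma : nat -> nat -> nat) (hd : (2 <= d)%N) (hq : (2 <= q)%N)
  (hm : alphabets d m) (hp : is_p R d m q p)
  (hsigma : is_sigma d (a_ R d m q p) sigma).

Let a := a_ R d m q p.

Lemma q_gt0 : 0 < q%:R :> R. Proof. by rewrite ltr0n ltnW. Qed.

Lemma aE k : a k = q%:R ^+ p k * log_ratio R d m k. Proof. by []. Qed.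

Lemma a_bounds k : (1 <= k <= d.-1)%N ->
  a k <= 1 /\ 1 < q%:R ^+ (p k).+1 * log_ratio R d m k.
Proof.
move=> hk; have /andP[h1 h2] := hp hk.
rewrite -[\prod_(_ <= _ < _) _]/(log_ratio R d m k) in h1 h2.
have /andP[g0 _] : 0 < log_ratio R d m k <= 1 by apply: (log_ratio_bounds R hm); lia.
split; first by rewrite aE -ler_pdivlMr// div1r.
by rewrite -ltr_pdivrMr// div1r.
Qed.

Lemma log_ratio_le j k : (1 <= j)%N -> (j <= k)%N -> (k <= d)%N ->
  log_ratio R d m j <= log_ratio R d m k.
Proof.
move=> j1; elim: k => [|k IH]; first by case: j j1.
rewrite leq_eqVlt => /predU1P[->//|jk kd].
apply: le_trans (IH jk (ltnW kd)) _; rewrite log_ratioS//.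
have /andP[g0 g1] : 0 < gamma R m k.+1 <= 1.
  by apply: (gamma_bounds R hm); lia.
have /andP[r0 _] := @log_ratio_bounds R d m k.+1 hm isT.
by rewrite ler_piMl// ltW.
Qed.

(** If p_j < p_k with j <= k, then a_k >= q^(p_j + 1) g_j > 1, which is
    excluded. *)
Lemma p_anti j k : (1 <= j)%N -> (j <= k)%N -> (k <= d.-1)%N -> (p k <= p j)%N.
Proof.
move=> j1 jk kd; rewrite leqNgt; apply/negP => pjk.
have [ak _] : a k <= 1 /\ 1 < q%:R ^+ (p k).+1 * log_ratio R d m k.
  by apply: a_bounds; lia.
have [_ aj] : a j <= 1 /\ 1 < q%:R ^+ (p j).+1 * log_ratio R d m j.
  by apply: a_bounds; lia.
have : a k > 1.
  apply: lt_le_trans aj _; rewrite aE; apply: ler_pM.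
  - by rewrite exprn_ge0.
  - by have /andP[/ltW] := @log_ratio_bounds R d m j hm j1.
  - by rewrite ler_eXn2l// ltr1n.
  - by apply: log_ratio_le => //; lia.
by rewrite ltNge ak.
Qed.

Lemma sigma_range s t : (1 <= s)%N -> (s <= t <= d.-1)%N ->
  (s <= sigma s t <= d.-1)%N.
Proof.
move=> s1 st; have [|/perm_mem/(_ (sigma s t)) + _] := hsigma (s := s); first by lia.
rewrite mem_iota map_f ?mem_iota; last by lia.
by move=> /esym; lia.
Qed.

Lemma sigma_onto s k : (1 <= s)%N -> (s <= k <= d.-1)%N ->
  exists2 t, (s <= t <= d.-1)%N & sigma s t = k.
Proof.
move=> s1 sk; have [|/perm_mem/(_ k) + _] := hsigma (s := s); first by lia.
rewrite mem_iota => E; have : k \in [seq sigma s t | t <- iota s (d - s)].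
  by rewrite E; lia.
by move=> /mapP[t]; rewrite mem_iota => ht ->; exists t => //; lia.
Qed.

Lemma a_sigma_le s t t' : (1 <= s)%N -> (s <= t)%N -> (t <= t')%N ->
  (t' <= d.-1)%N -> a (sigma s t) <= a (sigma s t').
Proof.
move=> s1 st tt' td.
have [->//|{}tt'] : t = t' \/ (t < t')%N by lia.
have [|_ H] := hsigma (s := s); first by lia.
by have [] := H t t' st tt' td.
Qed.

Lemma raisedP s t k : (1 <= s)%N -> (s <= k <= d.-1)%N -> (s.-1 <= t <= d.-1)%N ->
  reflect (exists2 u, (s <= u <= t)%N & sigma s u = k)
    (k \in [seq sigma s i | i <- iota s (t.+1 - s)]).
Proof.
move=> s1 sk st; apply: (iffP mapP) => [[u]|[u hu <-]].
  by rewrite mem_iota => hu ->; exists u => //; lia.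
by exists u => //; rewrite mem_iota; lia.
Qed.

Lemma p_st_bounds s t k : (p k <= p_st p sigma s t k <= (p k).+1)%N.
Proof. by rewrite /p_st; case: ifP => _; rewrite ?leqnn ?leqnSn. Qed.

(** The only danger is p_{k+1} = p_k with p_{k+1} raised and p_k not.  Then
    a_k <= a_{k+1}, so that sigma_s lists k before k + 1, ties being ordered by
    index: k is raised no later than k + 1. *)
Lemma p_st_anti s t k : (1 <= s)%N -> (s <= k)%N -> (k < d.-1)%N ->
  (s.-1 <= t <= d.-1)%N -> (p_st p sigma s t k.+1 <= p_st p sigma s t k)%N.
Proof.
move=> s1 sk kd st.
have := p_anti (j := k) (k := k.+1) ltac:(lia) (leqnSn _) ltac:(lia).
rewrite leq_eqVlt => /predU1P[E|lt]; last first.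
  have /andP[_ h1] := p_st_bounds s t k.+1; have /andP[h2 _] := p_st_bounds s t k.
  by apply: leq_trans h1 (leq_trans lt h2).
rewrite /p_st; case: ifPn => [/raisedP h|_]; last by rewrite E; case: ifP.
have [|||u hu Eu] := h; [lia..|].
have [u' hu' Eu'] := @sigma_onto s k s1 ltac:(lia).
suff -> : k \in [seq sigma s i | i <- iota s (t.+1 - s)] by rewrite E.
apply/raisedP; [lia..|exists u' => //].
have [u'u|uu'] := leqP u' u; first by lia.
have [|_ H] := hsigma (s := s); first by lia.
have [le eq] := H u u' ltac:(lia) uu' ltac:(lia).
rewrite Eu Eu' in le eq.
have := eq _; suff Ea : a k.+1 = a k by move=> /(_ Ea); lia.
apply/eqP; rewrite eq_le le/= aE [leRHS]aE E ler_wpM2l ?exprn_ge0//.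
by apply: log_ratio_le; lia.
Qed.

(** The end points 1/q and 1, and between them the jumps, of the shape seen as a
    function of y at a level r with p_s < r <= p_{s-1}; step t goes from breakpoint t to breakpoint t + 1.
    For s = d there is a single step, from 1/q to 1. *)
Definition breakpoint (s t : nat) : R :=
  if t == s.-1 then q%:R^-1 else if t == d then 1 else a (sigma s t).

Lemma breakpoint_bounds s t : (1 <= s <= d)%N -> (s.-1 <= t <= d)%N ->
  q%:R^-1 <= breakpoint s t <= 1.
Proof.
move=> hs ht; have qi : (q%:R : R)^-1 <= 1.
  by rewrite invf_le1 ?q_gt0// ler1n ltnW.
rewrite /breakpoint; case: eqVneq => [_|ts]; first by rewrite lexx.
case: eqVneq => [_|td]; first by rewrite lexx qi.
have hst : (s <= sigma s t <= d.-1)%N by apply: sigma_range; lia.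
have [le lt] := a_bounds (k := sigma s t) ltac:(lia).
rewrite le andbT -(ler_pM2l q_gt0) divff ?gt_eqF ?q_gt0//.
by rewrite aE mulrA -exprS ltW.
Qed.

Lemma breakpoint_mono s t : (1 <= s <= d)%N -> (s.-1 <= t < d)%N ->
  breakpoint s t <= breakpoint s t.+1.
Proof.
move=> hs ht; have [-> |ts] := eqVneq t s.-1.
  rewrite {1}/breakpoint eqxx.
  by have /andP[] := breakpoint_bounds hs (t := s.-1.+1) ltac:(lia).
have [td|td] := eqVneq t.+1 d.
  rewrite [leRHS]/breakpoint td eqxx ifF; last by lia.
  by have /andP[] := breakpoint_bounds hs (t := t) ltac:(lia).
rewrite /breakpoint (negbTE ts) (negbTE td) !ifF; [|lia..].
by apply: a_sigma_le; lia.
Qed.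

Lemma raised_le_breakpoint s t k : (1 <= s <= d)%N -> (s <= k <= d.-1)%N ->
  (s.-1 <= t < d)%N -> k \in [seq sigma s i | i <- iota s (t.+1 - s)] ->
  a k <= breakpoint s t.
Proof.
move=> hs hk ht /raisedP h; have [|||u hu <-] := h; [lia..|].
rewrite /breakpoint !ifF; [|lia..].
by apply: a_sigma_le; lia.
Qed.

Lemma breakpoint_le_unraised s t k : (1 <= s <= d)%N -> (s <= k <= d.-1)%N ->
  (s.-1 <= t < d)%N -> k \notin [seq sigma s i | i <- iota s (t.+1 - s)] ->
  breakpoint s t.+1 <= a k.
Proof.
move=> hs hk ht kn; have [u hu E] := sigma_onto (s := s) ltac:(lia) hk.
have tu : (t < u)%N.
  rewrite ltnNge; apply: contra kn => ut; apply/raisedP; [lia..|].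
  by exists u => //; lia.
rewrite /breakpoint !ifF; [|lia..].
by rewrite -E; apply: a_sigma_le; lia.
Qed.

(** The case distinction in the definition of delta is the one in the definition
    of the end points of step t. *)
Lemma deltaE s t r : (1 <= s <= d)%N -> (s.-1 <= t < d)%N ->
  delta d q a sigma s t r =
  (breakpoint s t.+1 - breakpoint s t) * (q%:R - 1) / q%:R ^+ r.
Proof.
move=> hs ht; have q0 := q_gt0; have qn : q%:R != 0 :> R by rewrite gt_eqF.
have qrn : q%:R ^+ r != 0 :> R by rewrite expf_neq0.
rewrite /delta; case: eqVneq => [sd|sd].
  have td : t = d.-1 by lia.
  rewrite /breakpoint td sd eqxx prednK; last by lia.
  rewrite eqxx ifF; last by lia.
  by rewrite [q%:R ^+ r.+1]exprS; field; rewrite qn qrn.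
case: eqVneq => [ts|ts].
  rewrite ts /breakpoint prednK; last by lia.
  rewrite eqxx (negbTE sd) ifF; last by lia.
  by rewrite [q%:R ^+ r.+1]exprS; field; rewrite qn qrn.
case: eqVneq => [td|td].
  have td1 : t.+1 = d by lia.
  rewrite /breakpoint td1 eqxx (negbTE ts) -td !ifF//; lia.
rewrite /breakpoint (negbTE ts) !ifF//; lia.
Qed.

(** The levels r attached to s: p_s < r <= p_{s-1}, where s = 1 has no upper
    bound and s = d no lower bound other than 0. *)
Definition level_range (s r : nat) : Prop :=
  [/\ (1 <= s <= d)%N, (0 < r)%N, (s < d)%N -> (p s < r)%N &
      (1 < s)%N -> (r <= p s.-1)%N].

(** The number of observed values of coordinate k on the step t of level r. *)
Definition profile (s t r k : nat) : nat :=
  if k == d then r else if (k < s)%N then 0%N else (r - p_st p sigma s t k)%N.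

(** All positions are multiplied by Q = q^(r-1).  The margin d kept from both
    ends of the step absorbs the difference between ell_k and g_k ell_d,
    which is at most d.  That i q^e > ell_k is read off the lower end of the step
    or off i > ell_d / q^r, and that i q^(e-1) <= ell_k off its upper end or off
    i <= ell_d / q^(r-1); which one is needed depends on whether a_k is to the
    left or to the right of the step. *)
Lemma fiber_profile s t r n i k : level_range s r -> (s.-1 <= t < d)%N ->
  (0 < i)%N -> (1 <= k <= d)%N ->
  breakpoint s t * ((ball_length R m n d)%:R / q%:R ^+ r.-1) + d%:R <= i%:R ->
  i%:R + d%:R <= breakpoint s t.+1 * ((ball_length R m n d)%:R / q%:R ^+ r.-1) ->
  count_powers q (ball_length R m n k) i = profile s t r k.
Proof.
move=> [hs r0 rs rs'] ht i0 hk.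
have kd1 : k != d -> (1 <= k <= d.-1)%N by lia.
have skd : (s <= k < d)%N -> (s <= k <= d.-1)%N by lia.
(* The exponents that relate q^(r-1) to q^(p_k) in the two cases. *)
have expU : (p k < r)%N -> (p k + (r - p k) = r)%N by lia.
have expU1 : (p k < r)%N -> (p k + (r - p k).-1 = r.-1)%N by lia.
have expR : (p k < r)%N -> (p k + (r - (p k).+1) = r.-1)%N by lia.
have expR1 : (0 < r - (p k).+1)%N ->
  ((p k).+1 + (r - (p k).+1).-1 = r.-1)%N by lia.
have p_low : (k < s)%N -> (r <= p k)%N.
  by move=> ks; apply: leq_trans (rs' _) (p_anti _ _ _); lia.
have p_high : (s <= k < d)%N -> (p k < r)%N.
  by move=> sk; apply: leq_ltn_trans (p_anti _ _ _) (rs _); lia.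
have /andP[b1 b2] := breakpoint_bounds hs (t := t) ltac:(lia).
have /andP[b3 b4] := breakpoint_bounds hs (t := t.+1) ltac:(lia).
have /andP[gap1 gap2] := Lcomp_gap R n hm hk.
rewrite -!/(ball_length R m n _) in gap1 gap2.
have q0 := q_gt0; have q1 : 1 <= q%:R :> R by rewrite ler1n ltnW.
have Q1 : 1 <= q%:R ^+ r.-1 :> R by rewrite exprn_ege1.
have Q0 : 0 < q%:R ^+ r.-1 :> R by apply: lt_le_trans Q1.
have d0 : 0 < d%:R :> R by rewrite ltr0n ltnW.
have raised := raised_le_breakpoint hs (k := k) ^~ ht.
have unraised := breakpoint_le_unraised hs (k := k) ^~ ht.
have abounds := @a_bounds k.
have [g0 _] := andP (@log_ratio_bounds R d m k hm (proj1 (andP hk))).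
rewrite !aE in raised unraised abounds; rewrite !mulrA.
have LT : k = d -> ball_length R m n k = ball_length R m n d by move=> ->.
move: (ball_length R m n k) (ball_length R m n d) gap1 gap2 LT => L Tn gap1 gap2 LT.
move: (breakpoint s t) (breakpoint s t.+1) b1 b2 b3 b4 raised unraised
  => b b' b1 b2 b3 b4 raised unraised.
move: (log_ratio R d m k) g0 gap1 gap2 raised unraised abounds
  => g g0 gap1 gap2 raised unraised abounds lo hi.
have {}lo : b * Tn%:R + d%:R * q%:R ^+ r.-1 <= i%:R * q%:R ^+ r.-1.
  by move: lo; rewrite -lerBrDr ler_pdivrMr// mulrBl lerBrDr.
have {}hi : i%:R * q%:R ^+ r.-1 + d%:R * q%:R ^+ r.-1 <= b' * Tn%:R.
  by move: hi; rewrite ler_pdivlMr// mulrDl.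
have T0 : 0 <= Tn%:R :> R by [].
have dQ : 0 < d%:R * q%:R ^+ r.-1 :> R by rewrite mulr_gt0.
have loT : Tn%:R < i%:R * q%:R ^+ r :> R.
  rewrite -(prednK r0) exprSr mulrA.
  apply: (@le_lt_trans _ _ (b * Tn%:R * q%:R)).
    by rewrite -mulrA [Tn%:R * _]mulrC mulrA ler_peMl// -ler_pdivrMr// div1r.
  by rewrite ltr_pM2r//; apply: lt_le_trans lo; rewrite ltrDl.
have hiT : i%:R * q%:R ^+ r.-1 <= Tn%:R :> R.
  apply: (@le_trans _ _ (b' * Tn%:R)); last by rewrite ler_piMl.
  by apply: le_trans hi; rewrite lerDl ltW.
have nat_lt e (M : nat) : M%:R < i%:R * q%:R ^+ e :> R -> (M < i * q ^ e)%N.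
  by rewrite -natrX -natrM ltr_nat.
have nat_le e (M : nat) : i%:R * q%:R ^+ e <= M%:R :> R -> (i * q ^ e <= M)%N.
  by rewrite -natrX -natrM ler_nat.
rewrite /profile; case: eqVneq => [kd|kd].
  by apply: count_powers_eq => // [|_]; [apply: nat_lt|apply: nat_le]; rewrite LT.
have kd' : (k < d)%N by rewrite ltn_neqAle kd; case/andP: hk.
have [ak1 ak2] := abounds (kd1 kd).
have X0 e : 0 < q%:R ^+ e :> R by rewrite exprn_gt0.
case: ltnP => [ks|sk].
  apply: count_powers_eq => //; apply: nat_lt; rewrite expr0 mulr1.
  rewrite -(ltr_pM2l (X0 r)) [ltRHS]mulrC; apply: le_lt_trans loT.
  apply: (@le_trans _ _ (q%:R ^+ r * (g * Tn%:R))); first by rewrite ler_pM2l.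
  rewrite mulrA ler_piMl//; apply: le_trans ak1.
  by rewrite ler_pM2r// ler_weXn2l// p_low.
have pkr : (p k < r)%N by rewrite p_high// sk.
have XT (e : nat) : q%:R ^+ e * L%:R <= q%:R ^+ e * g * Tn%:R.
  by rewrite -mulrA ler_pM2l.
have TX (e : nat) (c : R) : (e <= r.-1)%N -> c <= q%:R ^+ e * g * Tn%:R ->
    c - d%:R * q%:R ^+ r.-1 <= q%:R ^+ e * L%:R.
  move=> er; rewrite -mulrA => h; rewrite lerBlDr; apply: le_trans h _.
  apply: (@le_trans _ _ (q%:R ^+ e * (L%:R + d%:R))); first by rewrite ler_pM2l.
  by rewrite mulrDr lerD2l mulrC ler_pM2l// ler_weXn2l.
have {}hi : i%:R * q%:R ^+ r.-1 <= b' * Tn%:R - d%:R * q%:R ^+ r.-1.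
  by rewrite lerBrDr.
have powE (e f c : nat) : (e + f)%N = c ->
    q%:R ^+ e * (i%:R * q%:R ^+ f) = i%:R * q%:R ^+ c :> R.
  by move=> <-; rewrite mulrCA exprD.
have hk' : (s <= k <= d.-1)%N by rewrite skd// sk.
rewrite /p_st; case: ifPn => [/(raised hk') aleb|/(unraised hk') bleb].
  apply: count_powers_eq => // [|e0].
    apply: nat_lt; rewrite -(ltr_pM2l (X0 (p k))) (powE _ _ _ (expR pkr)).
    apply: lt_le_trans lo; apply: (@le_lt_trans _ _ (b * Tn%:R)).
      by apply: le_trans (XT _) _; rewrite ler_wpM2r.
    by rewrite ltrDl.
  apply: nat_le; rewrite -(ler_pM2l (X0 (p k).+1)) (powE _ _ _ (expR1 e0)).
  apply: le_trans hi (TX _ _ _ _); first by rewrite -(expR1 e0) leq_addr.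
  rewrite ler_wpM2r//; exact: le_trans b4 (ltW ak2).
apply: count_powers_eq => // [|e0].
  apply: nat_lt; rewrite -(ltr_pM2l (X0 (p k))) (powE _ _ _ (expU pkr)).
  by apply: le_lt_trans loT; apply: le_trans (XT _) _; rewrite ler_piMl.
apply: nat_le; rewrite -(ler_pM2l (X0 (p k))) (powE _ _ _ (expU1 pkr)).
by apply: le_trans hi (TX _ _ _ _); [rewrite -(expU1 pkr) leq_addr|rewrite ler_wpM2r].
Qed.

(** The blocks up to the k-th have total length 0 for k < s, then
    r - p_k^{s,t} for s <= k < d by telescoping, and r for k = d.  As p_k^{s,t}
    is non-increasing in k, no subtraction is truncated. *)
Lemma profile_prefix_lengths s t r k : (1 <= s < d)%N -> (p s < r)%N ->
  (s.-1 <= t < d)%N -> (k < d)%N ->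
  (\sum_(1 <= j < k.+2) prefix_lengths d s (p_st p sigma s t) r j)%N =
  profile s t r k.+1.
Proof.
move=> hs pr ht kd; set P := p_st p sigma s t.
have Pr : (P s <= r)%N.
  by have /andP[_ h] := p_st_bounds s t s; apply: leq_trans h pr.
have sum e : (e < d)%N -> (\sum_(1 <= j < e.+1) prefix_lengths d s P r j)%N =
    if (e < s)%N then 0%N else (r - P e)%N.
  have PrK e' : (s <= e' < d)%N -> (P e' <= r)%N.
    elim: e' => [|e' IH he]; first by lia.
    have [<-//|se] : s = e'.+1 \/ (s <= e')%N by lia.
    by apply: leq_trans (p_st_anti _ _ _ _) (IH _); lia.
  elim: e => [_|e IH ed]; first by rewrite big_geq// ifT//; lia.
  rewrite big_nat_recr//= IH; last by lia.
  rewrite /prefix_lengths; case: (ltngtP e.+1 s) => [es|se|es].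
  - by [].
  - rewrite ed/=; have h1 := PrK e ltac:(lia).
    have := @p_st_anti s t e ltac:(lia) ltac:(lia) ltac:(lia) ltac:(lia).
    rewrite -/P; lia.
  - by rewrite es.
rewrite /profile; case: eqVneq => [kd'|kd'].
  rewrite big_nat_recr//= sum; last by lia.
  rewrite ifF; last by lia.
  rewrite /prefix_lengths kd' !ifF; [|lia..].
  have E : k = d.-1 by lia.
  rewrite E; have : (P d.-1 <= r)%N; last by lia.
  have /andP[_ h] := p_st_bounds s t d.-1.
  have h2 : (p d.-1 <= p s)%N by apply: p_anti; lia.
  by apply: leq_trans h _; lia.
by rewrite sum; [|lia].
Qed.

Lemma profile_last_lengths t r k : (k < d)%N ->
  (\sum_(1 <= j < k.+2) last_lengths d r j)%N = profile d t r k.+1.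
Proof.
move=> kd; rewrite big_nat_recr//= big1_seq; last first.
  move=> j /andP[_]; rewrite mem_index_iota /last_lengths => hj.
  by rewrite ifF//; lia.
by rewrite add0n /last_lengths /profile; case: eqVneq => // ne; rewrite ifT//; lia.
Qed.

End Levels.

(** * Asymptotic contribution of each level *)

Lemma cvg_ratio (R : realType) (T : Type) (F : set_system T) (FF : Filter F)
    (X Y : T -> R) (c E : R) :
  (\forall t \near F, `|X t - c * Y t| <= E) -> Y @ F --> +oo ->
  (fun t => X t / Y t) @ F --> c.
Proof.
move=> XY Yoo; apply/cvgrPdist_le => e e0; near=> t.
have h1 : `|X t - c * Y t| <= E by near: t; exact: XY.
have h2 : 1 <= Y t by near: t; exact: (cvgry_ge Yoo).
have h3 : E / e <= Y t by near: t; exact: (cvgry_ge Yoo).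
have Y0 : 0 < Y t by apply: lt_le_trans h2.
rewrite (_ : c - X t / Y t = - ((X t - c * Y t) / Y t)); last first.
  by field; rewrite gt_eqF.
rewrite normrN normrM normfV (gtr0_norm Y0) ler_pdivrMr// [leRHS]mulrC.
by apply: le_trans h1 _; rewrite -ler_pdivrMr.
Unshelve. all: by end_near. Qed.

Lemma truncn_divn (R : realType) (a b : nat) : (0 < b)%N ->
  Num.truncn (a%:R / b%:R : R) = (a %/ b)%N.
Proof.
move=> b0; apply: truncn_def; rewrite ler_pdivlMr ?ltr0n// -natrM ler_nat.
by rewrite ltr_pdivrMr ?ltr0n// -natrM ltr_nat leq_divM ltn_ceil.
Qed.

Lemma patterns_le (d : nat) (m : nat -> nat) (Omega : set (Sigma d m))
    (h : 'I_d -> nat) (e : nat) : alphabets d m -> (forall k, (h k <= e)%N) ->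
  (patterns Omega h <= m 1 ^ (e * d))%N.
Proof.
move=> hm he; apply: leq_trans (max_card _) _.
rewrite card_dep_ffun foldrE big_map big_enum /=.
rewrite expnM -[X in (_ <= _ ^ X)%N](card_ord d) -prod_nat_const.
apply: leq_prod => k _; rewrite card_ffun !card_ord.
have kd := ltn_ord k.
have mk : (m k.+1 <= m 1)%N by apply: (alphabet_le hm).
have m1 : (0 < m 1)%N by apply: ltnW; apply: (alphabet_ge2 hm); lia.
apply: (@leq_trans (m 1 ^ h k)%N); last by rewrite leq_pexp2l.
by case: (h k) => // j; rewrite leq_exp2r.
Qed.

Lemma ln_patterns_bounds (R : realType) (d : nat) (m : nat -> nat)
    (Omega : set (Sigma d m)) (h : 'I_d -> nat) (e : nat) : (1 <= d)%N ->
  alphabets d m -> Omega !=set0 -> (forall k, (h k <= e)%N) ->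
  0 <= (ln (patterns Omega h)%:R : R) <= e%:R * (d%:R * ln (m 1%N)%:R).
Proof.
move=> d1 hm O0 he; have P1 : (1 <= patterns Omega h)%N by exact: nvalues_gt0.
have m1 : (0 < m 1%N)%N by apply: ltnW; apply: (alphabet_ge2 hm); rewrite d1.
rewrite ln_ge0 ?ler1n//= mulrA -natrM mulr_natl -lnXn ?ltr0n//.
by rewrite ler_ln ?posrE ?exprn_gt0 ?ltr0n// -natrX ler_nat; apply: patterns_le.
Qed.

(** A geometric domination of r / 2^(r-1), from r + 2 <= 2 (3/2)^r. *)
Lemma linear_le_geometric (R : realType) (r : nat) :
  r%:R / 2 ^+ r.-1 <= 4 * (3 / 4) ^+ r :> R.
Proof.
case: r => [|r]; first by rewrite mul0r expr0.
have H : r.+1%:R + 2 <= 2 * (3 / 2) ^+ r.+1 :> R.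
  elim: r => [|r IH]; first by rewrite expr1; lra.
  rewrite exprS -[r.+2%:R]natr1; move: ((3 / 2) ^+ r.+1) IH => x.
  rewrite -[r.+1%:R]natr1; have := ler0n R r; lra.
rewrite ler_pdivrMr ?exprn_gt0//=.
have E : (3 / 4) ^+ r.+1 * 2 ^+ r = (3 / 2) ^+ r.+1 / 2 :> R.
  apply: (@mulIf _ 2); rewrite ?pnatr_eq0// -mulrA -exprSr -exprMn divfK//.
  by congr (_ ^+ _); field.
rewrite -mulrA E; lra.
Qed.

Lemma leq_div_exp (q n e e' : nat) : (0 < q)%N -> (e <= e')%N ->
  (n %/ q ^ e' <= n %/ q ^ e)%N.
Proof.
by move=> q0 ee'; apply: leq_div2l; rewrite ?expn_gt0 ?q0// leq_pexp2l.
Qed.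

Section Counting.
Context (R : realType) (d q : nat) (m p : nat -> nat)
  (sigma : nat -> nat -> nat) (hd : (2 <= d)%N) (hq : (2 <= q)%N)
  (hm : alphabets d m) (hp : is_p R d m q p)
  (hsigma : is_sigma d (a_ R d m q p) sigma)
  (Omega : set (Sigma d m)) (O0 : Omega !=set0).

Let T n := ball_length R m n d.
Let a := a_ R d m q p.

(** The contribution of the progression of i to the logarithm of the number of
    balls B_n. *)
Definition fiber_entropy (n i : nat) : R :=
  ln (patterns Omega (fiber_lengths q (ball_length R m n) i))%:R.

(** The level r consists of the i with ell_d / q^r < i <= ell_d / q^(r-1), for
    which coordinate d is observed exactly r times.  For r = 0 the sum is
    empty. *)
Definition level_sum (n r : nat) : R :=
  \sum_((T n %/ q ^ r).+1 <= i < (T n %/ q ^ r.-1).+1 | ~~ (q %| i)%N)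
    fiber_entropy n i.

Definition profile_entropy (s t r : nat) : R :=
  ln (patterns Omega (fun k : 'I_d => profile d p sigma s t r k.+1))%:R.

Lemma last_length_ge n : (n <= T n)%N.
Proof. by rewrite -[leqLHS](Lcomp1 R m); apply: (Lcomp_le R n hm) => //; lia. Qed.

Lemma last_length_cvg : (fun n => (T n)%:R : R) @ \oo --> +oo.
Proof.
apply/cvgryPge => A; exists (Num.truncn A).+1 => // n /= An.
apply: (@le_trans _ _ (n%:R)); last by rewrite ler_nat last_length_ge.
by apply/ltW; apply: lt_le_trans (truncnS_gt _) _; rewrite ler_nat.
Qed.

Lemma fiber_entropy_bounds n r i : (0 < i)%N -> (T n < i * q ^ r)%N ->
  0 <= fiber_entropy n i <= r%:R * (d%:R * ln (m 1%N)%:R).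
Proof.
move=> i0 iT; apply: ln_patterns_bounds => //; first by lia.
move=> k; rewrite leqNgt ltn_count_powers// -ltnNge; apply: leq_ltn_trans iT.
by apply: (Lcomp_le R n hm).
Qed.

Lemma level_index n r i : (T n %/ q ^ r < i)%N -> (T n < i * q ^ r)%N.
Proof. by rewrite ltn_divLR// expn_gt0 (ltnW hq). Qed.

(** The level r has at most ell_d / q^(r-1) elements, each contributing at most
    r d log m_1. *)
Lemma level_sum_bound n r :
  `|level_sum n r / (T n)%:R| <=
  geometric (4 * (d%:R * ln (m 1%N)%:R)) (3 / 4) r.
Proof.
have lnm0 : 0 <= ln (m 1%N)%:R :> R.
  by rewrite ltW// (ln_alphabet_gt0 R hm)//; lia.
have C0 : 0 <= d%:R * ln (m 1%N)%:R :> R by rewrite mulr_ge0.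
rewrite /= normrM normfV [`|(T n)%:R|]ger0_norm//.
have [T0|Tpos] := posnP (T n).
  by rewrite T0 invr0 mulr0 !mulr_ge0// exprn_ge0.
rewrite ler_pdivrMr ?ltr0n//.
have q0 e : 0 < q%:R ^+ e :> R by rewrite exprn_gt0// ltr0n (ltnW hq).
apply: (@le_trans _ _ (r%:R * (d%:R * ln (m 1%N)%:R) *
    ((T n)%:R / q%:R ^+ r.-1))).
  have le : (T n %/ q ^ r <= T n %/ q ^ r.-1)%N.
    exact: leq_div_exp (ltnW hq) (leq_pred r).
  apply: le_trans (@sum_norm_le R (fun i => ~~ (q %| i)%N) (fiber_entropy n)
    (r%:R * (d%:R * ln (m 1%N)%:R)) (T n %/ q ^ r).+1 (T n %/ q ^ r.-1).+1
    _ le _) _.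
  - by rewrite mulr_ge0.
  - move=> i /andP[h1 h2]; have i0 : (0 < i)%N by case: i h1 h2.
    by have /andP[e1 e2] := fiber_entropy_bounds i0 (level_index h1);
      rewrite ger0_norm.
  rewrite ler_wpM2l ?mulr_ge0// -!natr1 opprD addrACA subrr addr0.
  rewrite lerBlDr ler_wpDr//.
  by rewrite ler_pdivlMr// -natrX -natrM ler_nat leq_divM.
have := linear_le_geometric R r; rewrite ler_pdivrMr ?exprn_gt0// => lin.
rewrite [leLHS]mulrA [leLHS]mulrAC ler_wpM2r// ler_pdivrMr//.
rewrite [leRHS](_ : _ = (4 * (3 / 4) ^+ r * q%:R ^+ r.-1) *
  (d%:R * ln (m 1%N)%:R)); last by ring.
rewrite ler_wpM2r//; apply: le_trans lin _; rewrite ler_wpM2l//.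
by rewrite lerXn2r ?nnegrE// ler_nat.
Qed.

Lemma level_sum_big n : \sum_(0 <= r < (T n).+1) level_sum n r =
  \sum_(1 <= i < (T n).+1 | ~~ (q %| i)%N) fiber_entropy n i.
Proof.
(* The levels up to e cover ell_d / q^e < i <= ell_d; for e = ell_d this is
   everything, as ell_d < q^(ell_d). *)
suff H e : \sum_(0 <= r < e.+1) level_sum n r =
    \sum_((T n %/ q ^ e).+1 <= i < (T n).+1 | ~~ (q %| i)%N)
      fiber_entropy n i.
  by rewrite H divn_small// ltn_expl.
elim: e => [|e IH].
  by rewrite big_nat1 /level_sum expn0 divn1 !big_geq.
rewrite big_nat_recr//= IH addrC /level_sum/=.
rewrite -big_cat_nat//= ltnS; last by rewrite leq_div.
exact: leq_div_exp (ltnW hq) (leqnSn e).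
Qed.

Lemma level_sum_vanish n r : ((T n).+1 <= r)%N -> level_sum n r / (T n)%:R = 0.
Proof.
case: r => // r rT; have lt : (T n < q ^ r)%N.
  by apply: leq_ltn_trans (ltn_expl r hq).
have lt' : (T n < q ^ r.+1)%N by apply: ltn_trans lt _; rewrite ltn_exp2l.
by rewrite /level_sum/= !divn_small// big_geq// mul0r.
Qed.

(** On the level r the contribution of i is a step function of i / ell_d, up to a
    bounded number of exceptions near the jumps. *)
Lemma level_sum_cvg s r : level_range d p s r ->
  (fun n => level_sum n r / (T n)%:R) @ \oo -->
  \sum_(s.-1 <= t < d) delta d q a sigma s t r * profile_entropy s t r.
Proof.
move=> lr; have [hs r0 _ _] := lr.
pose C := r%:R * (d%:R * ln (m 1%N)%:R) : R.
pose E := (d - s.-1)%:R * (C * (4 * d%:R + 3)).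
apply: (@cvg_ratio _ _ _ _ _ _ _ E); last exact: last_length_cvg.
have q0 : 0 < q%:R :> R by rewrite ltr0n (ltnW hq).
have Q0 e : 0 < q%:R ^+ e :> R by rewrite exprn_gt0.
have prof k t i n : (s.-1 <= t < d)%N -> (0 < i)%N -> (1 <= k <= d)%N -> _ -> _ ->
    _ := fun ht i0 hk => @fiber_profile R d q m p sigma hd hq hm hp hsigma
      s t r n i k lr ht i0 hk.
near=> n.
pose b t := breakpoint R d q m p sigma s t * ((T n)%:R / q%:R ^+ r.-1).
have X0 : 0 <= (T n)%:R / q%:R ^+ r.-1 :> R by rewrite divr_ge0// ltW.
have bs : Num.truncn (b s.-1) = (T n %/ q ^ r)%N.
  rewrite -(truncn_divn R) ?expn_gt0 ?(ltnW hq)// natrX /b /breakpoint eqxx.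
  congr Num.truncn; rewrite -[in RHS](prednK r0) exprS.
  by field; rewrite !gt_eqF.
have be : Num.truncn (b d) = (T n %/ q ^ r.-1)%N.
  rewrite -(truncn_divn R) ?expn_gt0 ?(ltnW hq)// natrX /b /breakpoint eqxx.
  by rewrite ifF ?mul1r//; lia.
have mono t (ht : (s.-1 <= t < d)%N) :=
  breakpoint_mono hd hq hm hp hsigma hs ht.
have bnd t (ht : (s.-1 <= t <= d)%N) :=
  breakpoint_bounds hd hq hm hp hsigma hs ht.
have se : (s.-1 <= d)%N by lia.
have vC t : (s.-1 <= t < d)%N -> `|profile_entropy s t r| <= C.
  move=> _; have /andP[e1 e2] : 0 <= profile_entropy s t r <= C.
    apply: ln_patterns_bounds => //; first exact: ltnW.
    by move=> k; rewrite /profile; case: ifP => // _; case: ifP => // _;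
      exact: leq_subr.
  by rewrite ger0_norm.
have wC i : (Num.truncn (b s.-1) < i <= Num.truncn (b d))%N ->
    `|fiber_entropy n i| <= C.
  rewrite bs be => /andP[h1 _]; have i0 : (0 < i)%N by case: i h1.
  by have /andP[e1 e2] := fiber_entropy_bounds i0 (level_index h1);
    rewrite ger0_norm.
have wv t i : (s.-1 <= t < d)%N -> (0 < i)%N -> b t + d%:R <= i%:R ->
    i%:R + d%:R <= b t.+1 -> fiber_entropy n i = profile_entropy s t r.
  move=> ht i0 lo hi; rewrite /fiber_entropy /profile_entropy; congr (ln _%:R).
  congr (patterns _ _); apply/funext => k.
  by apply: (prof k.+1 t i n) => //; rewrite ltn_ord.
have := @step_sum R q d (fiber_entropy n) b (profile_entropy s ^~ r) C
  s.-1 d (ltnW hq) se _ _ vC wC wv.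
rewrite bs be => sm.
have Esum : \sum_(s.-1 <= t < d) delta d q a sigma s t r *
    profile_entropy s t r * (T n)%:R =
  (1 - q%:R^-1) * \sum_(s.-1 <= t < d)
    profile_entropy s t r * (b t.+1 - b t).
  rewrite mulr_sumr; apply: eq_big_nat => t ht.
  rewrite (deltaE R m p sigma hd hq r hs ht) /b.
  have -> : q%:R ^+ r = q%:R * q%:R ^+ r.-1 :> R by rewrite -exprS prednK.
  by field; rewrite !gt_eqF.
rewrite mulr_suml Esum; apply: sm => t ht.
- rewrite /b mulr_ge0//; have /andP[+ _] := bnd _ ht.
  by apply: le_trans; rewrite invr_ge0 ltW.
- by rewrite /b ler_wpM2r// mono.
Unshelve. all: by end_near. Qed.

Lemma level_range_ex r : (0 < r)%N -> exists s, level_range d p s r.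
Proof.
move=> r0; have exs : exists s, (0 < s)%N && ((s == d) || (p s < r)%N).
  by exists d; rewrite eqxx (ltnW hd).
case: (ex_minnP exs) => s /andP[s0 sP] smin; exists s.
have sd : (s <= d)%N by apply: smin; rewrite eqxx (ltnW hd).
split=> // [|ltsd|s1]; first by rewrite s0.
  by case/orP: sP => // /eqP E; rewrite E ltnn in ltsd.
rewrite leqNgt; apply/negP => lt; have := smin s.-1; rewrite lt orbT.
by case: s s1 {s0 sP sd smin lt} => // s s1; rewrite /= ltnn andbT => /(_ s1).
Qed.

Definition level_limit (r : nat) : R :=
  limn (fun n => level_sum n r / (T n)%:R).

Lemma level_limitE s r : level_range d p s r ->
  level_limit r =
  \sum_(s.-1 <= t < d) delta d q a sigma s t r * profile_entropy s t r.
Proof. by move=> /level_sum_cvg/cvg_lim; apply. Qed.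

Lemma level_limit0 : level_limit 0 = 0.
Proof.
rewrite /level_limit /level_sum.
under eq_fun do rewrite big_geq// mul0r.
exact: lim_cst.
Qed.

Lemma level_limit_cvg r :
  (fun n => level_sum n r / (T n)%:R) @ \oo --> level_limit r.
Proof.
case: r => [|r].
  rewrite level_limit0 /level_sum; under eq_fun do rewrite big_geq// mul0r.
  exact: cvg_cst.
have [s sr] := level_range_ex (ltn0Sn r).
by rewrite (level_limitE sr); exact: level_sum_cvg.
Qed.

(** The limit is log m_d times the dimension. *)
Lemma fiber_entropy_mean_cvg : cvgn (series level_limit) /\
  (fun n => (\sum_(1 <= i < (T n).+1 | ~~ (q %| i)%N) fiber_entropy n i)
     / (T n)%:R) @ \oo --> limn (series level_limit).
Proof.
have gM : cvgn (series (geometric (4 * (d%:R * ln (m 1%N)%:R)) (3 / 4 : R))).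
  by apply: is_cvg_geometric_series; rewrite ger0_norm; lra.
have [cl hlim] := tannery level_sum_bound gM level_limit_cvg level_sum_vanish.
split=> //; under eq_fun do rewrite -level_sum_big mulr_suml.
exact: hlim.
Qed.

End Counting.

(** * From radii to ball indices *)

Lemma ln_prod_nat (R : realType) (P : pred nat) (f : nat -> nat) (a b : nat) :
  (forall i, (0 < f i)%N) ->
  ln (\prod_(a <= i < b | P i) f i)%N%:R =
  \sum_(a <= i < b | P i) ln (f i)%:R :> R.
Proof.
move=> f0; suff [] : (0 < \prod_(a <= i < b | P i) f i)%N /\
    ln (\prod_(a <= i < b | P i) f i)%N%:R =
    \sum_(a <= i < b | P i) ln (f i)%:R :> R by [].
elim/big_rec2: _ => [|i x y _ [y0 <-]]; first by rewrite ln1.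
by rewrite muln_gt0 f0 y0 natrM lnM ?posrE ?ltr0n.
Qed.

Lemma ln_inv_cvg (R : realType) : (fun r : R => ln r^-1) @ 0^'+ --> +oo.
Proof.
apply/cvgryPge => A; near=> r.
have r0 : 0 < r by near: r; exact: nbhs_right_gt.
have rA : r <= expR (- A) by near: r; apply: nbhs_right_le; exact: expR_gt0.
rewrite lnV ?posrE// lerNr -[leRHS]expRK ler_ln ?posrE// expR_gt0//.
Unshelve. all: by end_near. Qed.

Lemma ball_index_cvg (R : realType) (d : nat) (m : nat -> nat) : alphabets d m ->
  (1 <= d)%N -> ball_index m r @[r --> (0 : R)^'+] --> \oo.
Proof.
move=> hm d1; have lnm : 0 < ln (m 1%N)%:R :> R.
  by apply: (ln_alphabet_gt0 R hm); rewrite d1.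
apply/cvgnyPge => A; near=> r.
have : A%:R * ln (m 1%N)%:R <= ln r^-1.
  by near: r; apply: (cvgry_ge (@ln_inv_cvg R)).
rewrite -ler_pdivlMr// => /le_trans h; rewrite -(ler_nat R); apply: h.
by rewrite -ball_index_le.
Unshelve. all: by end_near. Qed.

(** Both g_1 ell_d(n) - n and n - log (1/r) / log m_1 are bounded, where n is the
    index of the ball of radius r, and g_1 = log m_d / log m_1. *)
Lemma last_length_ball_index_cvg (R : realType) (d : nat) (m : nat -> nat) :
  alphabets d m -> (1 <= d)%N ->
  (ball_length R m (ball_index m r) d)%:R / ln r^-1 @[r --> (0 : R)^'+]
    --> (ln (m d)%:R)^-1.
Proof.
move=> hm d1; have lnm : 0 < ln (m 1%N)%:R :> R.
  by apply: (ln_alphabet_gt0 R hm); rewrite d1.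
have lnd : 0 < ln (m d)%:R :> R.
  by apply: (ln_alphabet_gt0 R hm); rewrite d1 leqnn.
apply: (@cvg_ratio _ _ _ _ _ _ _
  ((d%:R + 1) * ln (m 1%N)%:R / ln (m d)%:R)); last exact: ln_inv_cvg.
near=> r.
have y0 : 0 <= ln r^-1 by near: r; apply: (cvgry_ge (@ln_inv_cvg R)).
set y := ln r^-1 in y0 *; set n := ball_index m r; set T := ball_length R m n d.
have /andP[] := Lcomp_gap R n hm (k := 1) ltac:(lia).
rewrite Lcomp1 log_ratio1// -/(ball_length R m n d) -/T mulrAC.
rewrite ler_pdivlMr// ler_pdivrMr// => h1 h2.
have h3 : y <= n%:R * ln (m 1%N)%:R by rewrite -ler_pdivrMr// -ball_index_le.
have h4 : n%:R * ln (m 1%N)%:R <= y + ln (m 1%N)%:R.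
  case E : n => [|j]; first by rewrite mul0r addr_ge0// ltW.
  have : ~~ (n <= j)%N by rewrite E ltnn.
  rewrite ball_index_le ler_pdivrMr// -ltNge -/y -natr1 mulrDl mul1r => /ltW.
  by rewrite lerD2r.
rewrite (_ : T%:R - _ = (ln (m d)%:R * T%:R - y) / ln (m d)%:R); last first.
  by field; rewrite gt_eqF.
rewrite normrM normfV (gtr0_norm lnd) ler_wpM2r ?invr_ge0 ?(ltW lnd)//.
have d0 : 0 <= d%:R * ln (m 1%N)%:R :> R by rewrite mulr_ge0// ltW.
by rewrite mulrDl mul1r ler_norml; lra.
Unshelve. all: by end_near. Qed.

(** * The dimension formula *)

Section Assembly.
Context (R : realType) (d q : nat) (m p : nat -> nat)
  (sigma : nat -> nat -> nat) (hd : (2 <= d)%N) (hq : (2 <= q)%N)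
  (hm : alphabets d m) (hp : is_p R d m q p)
  (hsigma : is_sigma d (a_ R d m q p) sigma)
  (Omega : set (Sigma d m)) (O0 : Omega !=set0).

Let lam := @level_limit R d q m Omega.

Lemma level_termE s r : level_range d p s r -> (s < d)%N ->
  level_term R q Omega p sigma s r = lam r / ln (m d)%:R.
Proof.
move=> lr sd; have [/andP[s0 _] r0 pr _] := lr.
rewrite /lam (level_limitE hd hq hm hp hsigma O0 lr) mulr_suml.
apply: eq_big_nat => t ht; rewrite -mulrA; congr (_ * (ln _%:R / _)).
rewrite card_Pref; congr (patterns _ _); apply/funext => k.
by apply: (profile_prefix_lengths hd hq hm hp hsigma);
  rewrite ?s0 ?sd ?pr ?ltn_ord.
Qed.

Lemma last_termE r : level_range d p d r ->
  delta d q (a_ R d m q p) sigma d d.-1 r *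
    log_pref R Omega (last_lengths d r) = lam r / ln (m d)%:R.
Proof.
move=> lr; rewrite /lam (level_limitE hd hq hm hp hsigma O0 lr).
have E : (d = d.-1.+1)%N by rewrite prednK// ltnW.
rewrite [X in \sum_(_ <= _ < X) _]E big_nat1 -mulrA; congr (_ * (ln _%:R / _)).
rewrite card_Pref; congr (patterns _ _); apply/funext => k.
exact: (profile_last_lengths p sigma hd hq).
Qed.

(** The ranges p_s < r <= p_{s-1}, for s = d, ..., 2, are adjacent and together
    cover 1 <= r <= p_1. *)
Lemma head_termsE :
  \sum_(1 <= r < (p d.-1).+1) delta d q (a_ R d m q p) sigma d d.-1 r *
    log_pref R Omega (last_lengths d r)
  + \sum_(2 <= s < d) \sum_((p s).+1 <= r < (p s.-1).+1)
      level_term R q Omega p sigma s r =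
  series lam (p 1%N).+1 / ln (m d)%:R.
Proof.
have -> : series lam (p 1%N).+1 = \sum_(1 <= r < (p 1%N).+1) lam r.
  by rewrite /series/= big_ltn// /lam level_limit0 add0r.
rewrite mulr_suml.
have p_le s : (1 <= s < d)%N -> (p d.-1 <= p s)%N /\ (p s <= p 1)%N.
  by move=> hs; split; apply: (p_anti hd hq hm hp); lia.
have -> : \sum_(2 <= s < d) \sum_((p s).+1 <= r < (p s.-1).+1)
      level_term R q Omega p sigma s r =
    \sum_((p d.-1).+1 <= r < (p 1%N).+1) lam r / ln (m d)%:R.
  suff H e : (1 <= e < d)%N ->
      \sum_(2 <= s < e.+1) \sum_((p s).+1 <= r < (p s.-1).+1)
        level_term R q Omega p sigma s r =
      \sum_((p e).+1 <= r < (p 1%N).+1) lam r / ln (m d)%:R.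
    by rewrite -H; [rewrite prednK// ltnW|lia].
  elim: e => // -[_ _|e IH he]; first by rewrite !big_geq.
  rewrite big_nat_recr//= IH; last by lia.
  have pe : (p e.+2 <= p e.+1)%N by apply: (p_anti hd hq hm hp); lia.
  have [_ pe1] := p_le e.+1 ltac:(lia).
  rewrite [RHS](@big_cat_nat _ _ _ (p e.+1).+1)//= [RHS]addrC; congr (_ + _).
  apply: eq_big_nat => r hr; apply: level_termE; last by lia.
  by rewrite /= in hr; split=> //=; lia.
have [p1 _] := p_le 1%N ltac:(lia).
rewrite [RHS](@big_cat_nat _ _ _ (p d.-1).+1)//=; congr (_ + _).
by apply: eq_big_nat => r hr; apply: last_termE; split=> //; lia.
Qed.

Lemma tail_terms_cvg :
  (fun n => \sum_((p 1%N).+1 <= r < n) level_term R q Omega p sigma 1 r) @ \oo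
  --> (limn (series lam) - series lam (p 1%N).+1) / ln (m d)%:R.
Proof.
have [cl _] := fiber_entropy_mean_cvg hd hq hm hp hsigma O0.
apply: (@cvg_trans _ ((fun n => (series lam n - series lam (p 1%N).+1)
    / ln (m d)%:R) @ \oo)); last first.
  by apply: cvgMr_tmp; apply: cvgB (cvg_cst _).
apply: near_eq_cvg; near=> n.
have pn : ((p 1%N).+1 <= n)%N by near: n; exists (p 1%N).+1.
rewrite (_ : series lam n - _ = \sum_((p 1%N).+1 <= r < n) lam r); last first.
  by rewrite -sub_series_geq.
rewrite mulr_suml; apply: eq_big_nat => r /andP[pr _].
by rewrite level_termE//; split=> //; lia.
Unshelve. all: by end_near. Qed.

End Assembly.

Theorem theorem3p4 (R : realType) (d q : nat) (m : nat -> nat)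
    (hd : (2 <= d)%N) (hq : (2 <= q)%N)
    (hm : forall k, (1 <= k <= d.-1)%N -> (m k.+1 <= m k)%N)
    (hmd : (2 <= m d)%N)
    (Omega : set (Sigma d m)) (Omega0 : Omega !=set0) (Omega_cl : closed Omega)
    (p : nat -> nat) (hp : is_p R d m q p)
    (sigma : nat -> nat -> nat) (hsigma : is_sigma d (a_ R d m q p) sigma) :
  (* the series below converges *)
  cvgn (fun n => \sum_((p 1%N).+1 <= r < n)
                   level_term R q Omega p sigma 1 r) /\
  has_minkowski_dim (@dist R d m) (X_ q Omega)
    (\sum_(1 <= r < (p d.-1).+1)
        delta d q (a_ R d m q p) sigma d d.-1 r *
        log_pref R Omega (last_lengths d r)
     + \sum_(2 <= s < d) \sum_((p s).+1 <= r < (p s.-1).+1)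
         level_term R q Omega p sigma s r
     + \big[+%R/0]_((p 1%N).+1 <= r <oo)
         level_term R q Omega p sigma 1 r).
Proof.
have hA : alphabets d m by [].
have d1 : (1 <= d)%N by apply: ltnW.
have tail := tail_terms_cvg hd hq hA hp hsigma Omega0.
split; first by apply/cvg_ex; eexists; exact: tail.
pose T n := ball_length R m n d.
pose F n : R := \sum_(1 <= i < (T n).+1 | ~~ (q %| i)%N)
  fiber_entropy R q Omega n i.
exists (fun r => \prod_(1 <= i < (T (ball_index m r)).+1 | ~~ (q %| i)%N)
  patterns Omega (fiber_lengths q (ball_length R m (ball_index m r)) i))%N; split.
  by move=> r r0; apply: covering_number_X.
rewrite (cvg_lim _ tail)// head_termsE// mulrBl addrC subrK.
have [_ mean] := fiber_entropy_mean_cvg hd hq hA hp hsigma Omega0.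
have meanr : F (ball_index m r) / (T (ball_index m r))%:R @[r --> (0 : R)^'+] -->
    limn (series (@level_limit R d q m Omega)).
  by apply: cvg_comp (ball_index_cvg R hA d1) mean.
have both := cvgM meanr (@last_length_ball_index_cvg R d m hA d1).
apply: (cvg_trans _ (both _)); apply: near_eq_cvg; near=> r.
rewrite ln_prod_nat; last by move=> i; exact: nvalues_gt0.
change (F (ball_index m r) / (T (ball_index m r))%:R * ((T (ball_index m r))%:R / ln r^-1) =
  F (ball_index m r) / ln r^-1).
(* If ell_d = 0 the sum is empty, so both sides are 0. *)
have [T0|Tpos] := posnP (T (ball_index m r)).
  by rewrite T0 mul0r mulr0 /F T0 big_geq// mul0r.
by rewrite mulrA divfK// pnatr_eq0 -lt0n.
Unshelve. all: by end_near. Qed.
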